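(* Let $\mathcal{L}$ be any many-sorted signature. If $\Gamma\cup\{\varphi\}$ is a set of well-sorted $\mathcal{L}$-sentences, then $$\Gamma\vdash^{\mathcal{L}}_{\mathrm{MSL}}\varphi\quad\text{if and only if}\quad\Gamma^*,J^+\vdash_{\mathrm{FOL}}\varphi^*.$$
   Context: A many-sorted signature $\mathcal{L}$ consists of countable sets of relation and function symbols with arities (0-ary function symbols are constants); a nonempty countable set $\mathrm{Sort}$; pairwise disjoint countably infinite sets $\mathrm{Var}_i$ of variables of sort $i$, written $x^i$; and $\mathrm{rank}$ assigning to each $n$-ary relation symbol $R$ a nonempty $\mathrm{rank}(R)\subseteq\mathrm{Sort}^n$ and to each $n$-ary function symbol $f$ a nonempty partial function $\mathrm{rank}(f)\subseteq\mathrm{Sort}^n\times\mathrm{Sort}$. $R$ is strict if $\mathrm{rank}(R)$ is a singleton. Well-sorted terms: variables of $\mathrm{Var}_i$ have sort $i$; $f(t_1,\dots,t_n)$ has sort $i$ if the $t_k$ have sorts $i_k$ and $(i_1,\dots,i_n,i)\in\mathrm{rank}(f)$. Well-sorted formulas: $\bot$; $t_1=t_2$ for terms of the same sort; $R(t_1,\dots,t_n)$ when the tuple of sorts lies in $\mathrm{rank}(R)$; closure under $\land,\lor,\to,\exists x^i,\forall x^i$. $\Gamma\vdash^{\mathcal{L}}_{\mathrm{MSL}}\varphi$: derivability in classical natural deduction with sorted quantifier rules ($\forall E$, $\exists I$ instantiate a variable of sort $i$ only by well-sorted terms of sort $i$; usual eigenvariable conditions), all formulas well-sorted, plus universal closures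 of sorted equality axioms ($x^i=x^i$, symmetry and transitivity at each sort, congruence for $R$ at each tuple in $\mathrm{rank}(R)$ and for $f$ at each tuple in the domain of $\mathrm{rank}(f)$). $\vdash_{\mathrm{FOL}}$: classical unsorted natural deduction plus universal closures of the usual equality axioms (reflexivity, symmetry, transitivity, congruence for every relation and function symbol). Translation: unsorted signature with the symbols of $\mathcal{L}$ plus fresh unary $Q_i$ for each sort; $\bot^*=\bot$, atomic formulas unchanged, $*$ commutes with $\land,\lor,\to$, $(\forall x^i\varphi)^*=\forall x(Q_ix\to\varphi^* )$, $(\exists x^i\varphi)^*=\exists x(Q_ix\land\varphi^* )$. $J$: universal closures of $\exists x\,Q_ix$ for each sort $i$, and $Q_{i_1}x_1\land\dots\land Q_{i_n}x_n\to Q_if(x_1,\dots,x_n)$ for each function symbol $f$ and $(i_1,\dots,i_n,i)\in\mathrm{rank}(f)$. $J^+$ is $J$ together with the universal closures of: $Q_ix\to\neg Q_jx$ for all sorts $i\neq j$; $R(x_1,\dots,x_n)\to Q_{i_k}x_k$ for each strict relation symbol $R$ with $\mathrm{rank}(R)=\{(i_1,\dots,i_n)\}$ and each $1\le k\le n$; and, if $\mathrm{Sort}$ is finite, $\bigvee_{i\in\mathrm{Sort}}Q_ix$. *)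

(* Defs.v *)
From HB Require Import structures.
From mathcomp Require Import all_boot.
From Stdlib Require List.

Set Implicit Arguments.
Unset Strict Implicit.
Unset Printing Implicit Defensive.

(* First-order syntax with named variables, shared by the sorted and the
   unsorted logic: [V] is the set of variables, [F] and [P] are the function
   and relation symbols. *)

Record alphabet := Alphabet { symb :> countType; arity : symb -> nat }.

Inductive term (V : countType) (F : alphabet) : Type :=
| Var of V
| App (f : F) of {ffun 'I_(arity f) -> term V F}.

Inductive form (V : countType) (F P : alphabet) : Type :=
| Bot
| Eq of term V F & term V F
| Rel (R : P) of {ffun 'I_(arity R) -> term V F}
| And of form V F P & form V F P
| Or of form V F P & form V F P
| Imp of form V F P & form V F P
| All of V & form V F P
| Ex of V & form V F P.

Arguments Var {V F}.
Arguments App {V F}.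
Arguments Bot {V F P}.
Arguments Eq {V F P}.
Arguments Rel {V F P}.

Definition Neg (V : countType) (F P : alphabet)
    (A : form V F P) : form V F P := Imp A Bot.

(* [bigAnd] and [bigOr] put no unit at the end of a nonempty list. *)
Fixpoint bigAnd (V : countType) (F P : alphabet)
    (s : seq (form V F P)) : form V F P :=
  match s with
  | [::] => Neg Bot
  | [:: A] => A
  | A :: s' => And A (bigAnd s')
  end.

Fixpoint bigOr (V : countType) (F P : alphabet)
    (s : seq (form V F P)) : form V F P :=
  match s with
  | [::] => Bot
  | [:: A] => A
  | A :: s' => Or A (bigOr s')
  end.

(* [A_1 /\ ... /\ A_n -> B], which is [B] itself when [n = 0]. *)
Definition ImpAll (V : countType) (F P : alphabet)
    (s : seq (form V F P)) (B : form V F P) : form V F P :=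
  if s is [::] then B else Imp (bigAnd s) B.

Fixpoint tfv (V : countType) (F : alphabet) (t : term V F) : seq V :=
  match t with
  | Var x => [:: x]
  | App f ts => flatten [seq tfv (ts k) | k <- enum 'I_(arity f)]
  end.

Fixpoint fv (V : countType) (F P : alphabet) (A : form V F P) : seq V :=
  match A with
  | Bot => [::]
  | Eq t u => tfv t ++ tfv u
  | Rel R ts => flatten [seq tfv (ts k) | k <- enum 'I_(arity R)]
  | And B C | Or B C | Imp B C => fv B ++ fv C
  | All x B | Ex x B => [seq y <- fv B | y != x]
  end.

Definition sentence (V : countType) (F P : alphabet)
    (A : form V F P) : Prop := fv A = [::].

Definition univ_closure (V : countType) (F P : alphabet)
    (A : form V F P) : form V F P :=
  foldr (@All V F P) A (undup (fv A)).

Fixpoint tsubst (V : countType) (F : alphabet) (x : V) (t u : term V F) :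
    term V F :=
  match u with
  | Var y => if y == x then t else Var y
  | App f us => App f [ffun k => tsubst x t (us k)]
  end.

(* [subst x t A] is A[t/x]; it does not rename bound variables and is only
   used together with [free_for x t A]. *)
Fixpoint subst (V : countType) (F P : alphabet)
    (x : V) (t : term V F) (A : form V F P) : form V F P :=
  match A with
  | Bot => Bot
  | Eq u v => Eq (tsubst x t u) (tsubst x t v)
  | Rel R us => Rel R [ffun k => tsubst x t (us k)]
  | And B C => And (subst x t B) (subst x t C)
  | Or B C => Or (subst x t B) (subst x t C)
  | Imp B C => Imp (subst x t B) (subst x t C)
  | All y B => All y (if y == x then B else subst x t B)
  | Ex y B => Ex y (if y == x then B else subst x t B)
  end.

Fixpoint free_for (V : countType) (F P : alphabet)
    (x : V) (t : term V F) (A : form V F P) : bool :=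
  match A with
  | Bot | Eq _ _ | Rel _ _ => true
  | And B C | Or B C | Imp B C => free_for x t B && free_for x t C
  | All y B | Ex y B =>
      (x \notin fv A) || (y \notin tfv t) && free_for x t B
  end.

(* [eigen y x A G]: [y] may serve as eigenvariable for the bound variable [x]
   of [A], the formulas of [G] being the side formulas. *)
Definition eigen (V : countType) (F P : alphabet)
    (y x : V) (A : form V F P) (G : seq (form V F P)) :
    Prop :=
  [/\ free_for x (Var y) A, y = x \/ y \notin fv A
    & forall B, List.In B G -> y \notin fv B].

(* Classical natural deduction.  [nd wf inst G A]: there is a derivation of [A]
   whose open assumptions are in [G], in which all formulas satisfy [wf] and a
   variable [x] is instantiated by a term [t] only when [inst x t].  The [wf]
   premises are those needed for formulas that a rule does not build out of
   the conclusions of its premises. *)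
Inductive nd (V : countType) (F P : alphabet)
    (wf : form V F P -> Prop) (inst : V -> term V F -> Prop) :
    seq (form V F P) -> form V F P -> Prop :=
| nd_ass G A : wf A -> List.In A G -> nd wf inst G A
| nd_weak G G' A :
    (forall B, List.In B G -> List.In B G') -> nd wf inst G A -> nd wf inst G' A
| nd_raa G A : wf A -> nd wf inst (Neg A :: G) Bot -> nd wf inst G A
| nd_andI G A B : nd wf inst G A -> nd wf inst G B -> nd wf inst G (And A B)
| nd_andE1 G A B : nd wf inst G (And A B) -> nd wf inst G A
| nd_andE2 G A B : nd wf inst G (And A B) -> nd wf inst G B
| nd_orI1 G A B : wf B -> nd wf inst G A -> nd wf inst G (Or A B)
| nd_orI2 G A B : wf A -> nd wf inst G B -> nd wf inst G (Or A B)
| nd_orE G A B C :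
    nd wf inst G (Or A B) -> nd wf inst (A :: G) C -> nd wf inst (B :: G) C ->
    nd wf inst G C
| nd_impI G A B : wf A -> nd wf inst (A :: G) B -> nd wf inst G (Imp A B)
| nd_impE G A B : nd wf inst G (Imp A B) -> nd wf inst G A -> nd wf inst G B
| nd_allI G x y A :
    wf (All x A) -> inst x (Var y) -> eigen y x A G ->
    nd wf inst G (subst x (Var y) A) -> nd wf inst G (All x A)
| nd_allE G x t A :
    inst x t -> free_for x t A ->
    nd wf inst G (All x A) -> nd wf inst G (subst x t A)
| nd_exI G x t A :
    wf (Ex x A) -> inst x t -> free_for x t A ->
    nd wf inst G (subst x t A) -> nd wf inst G (Ex x A)
| nd_exE G x y A C :
    inst x (Var y) -> eigen y x A (C :: G) ->
    nd wf inst G (Ex x A) -> nd wf inst (subst x (Var y) A :: G) C ->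
    nd wf inst G C.

Definition eq_refl_ax (V : countType) (F P : alphabet)
    (x : V) : form V F P := Eq (Var x) (Var x).

Definition eq_sym_ax (V : countType) (F P : alphabet) (x y : V) : form V F P :=
  Imp (Eq (Var x) (Var y)) (Eq (Var y) (Var x)).

Definition eq_trans_ax (V : countType) (F P : alphabet)
    (x y z : V) : form V F P :=
  Imp (And (Eq (Var x) (Var y)) (Eq (Var y) (Var z))) (Eq (Var x) (Var z)).

Definition eq_rel_ax (V : countType) (F P : alphabet) (R : P)
    (x y : {ffun 'I_(arity R) -> V}) : form V F P :=
  ImpAll [seq Eq (Var (x k)) (Var (y k)) | k <- enum 'I_(arity R)]
    (Imp (Rel R [ffun k => Var (x k)]) (Rel R [ffun k => Var (y k)])).

Definition eq_fun_ax (V : countType) (F P : alphabet) (f : F)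
    (x y : {ffun 'I_(arity f) -> V}) : form V F P :=
  ImpAll [seq Eq (Var (x k)) (Var (y k)) | k <- enum 'I_(arity f)]
    (Eq (App f [ffun k => Var (x k)]) (App f [ffun k => Var (y k)])).

Arguments eq_rel_ax {V} F {P}.
Arguments eq_fun_ax {V F} P.

(* Unsorted first-order logic with equality.  Here and below, axiom schemes
   are taken for all choices of pairwise distinct variables. *)

Inductive fol_eq (V : countType) (F P : alphabet) : form V F P -> Prop :=
| fol_eq_refl x : fol_eq (univ_closure (eq_refl_ax F P x))
| fol_eq_sym x y :
    uniq [:: x; y] -> fol_eq (univ_closure (eq_sym_ax F P x y))
| fol_eq_trans x y z :
    uniq [:: x; y; z] -> fol_eq (univ_closure (eq_trans_ax F P x y z))
| fol_eq_rel (R : P) (x y : {ffun 'I_(arity R) -> V}) :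
    uniq (codom x ++ codom y) -> fol_eq (univ_closure (eq_rel_ax F R x y))
| fol_eq_fun (f : F) (x y : {ffun 'I_(arity f) -> V}) :
    uniq (codom x ++ codom y) -> fol_eq (univ_closure (eq_fun_ax P f x y)).

Definition fol_derives (V : countType) (F P : alphabet)
    (T : form V F P -> Prop) (A : form V F P) : Prop :=
  exists2 G : seq (form V F P),
    forall B, List.In B G -> T B \/ fol_eq B
    & nd (fun _ => True) (fun _ _ => True) G A.

(* Many-sorted signatures.  The sets Var_i are the fibres of [vsort] on a
   single set of variables, which makes them pairwise disjoint. *)

Record msl_sig := MslSig {
  sort : countType;
  sort_inh : inhabited sort;
  var : countType;
  vsort : var -> sort;
  var_inf : forall (i : sort) (s : seq var),
    exists2 x, vsort x = i & x \notin s;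
  funs : alphabet;
  rels : alphabet;
  frank : forall f : funs, {ffun 'I_(arity f) -> sort} -> sort -> Prop;
  frank_ne : forall f, exists i j, @frank f i j;
  frank_fun : forall f i j j', @frank f i j -> @frank f i j' -> j = j';
  rrank : forall R : rels, {ffun 'I_(arity R) -> sort} -> Prop;
  rrank_ne : forall R, exists i, @rrank R i
}.

Arguments frank {m}.
Arguments rrank {m}.

Definition strict (L : msl_sig) (R : rels L)
    (i : {ffun 'I_(arity R) -> sort L}) : Prop :=
  forall j, rrank R j <-> j = i.

Arguments strict {L}.

Definition sterm (L : msl_sig) := term (var L) (funs L).
Definition sform (L : msl_sig) := form (var L) (funs L) (rels L).

Inductive has_sort (L : msl_sig) : sterm L -> sort L -> Prop :=
| has_sort_var x : has_sort (Var x) (vsort x)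
| has_sort_app (f : funs L) (ts : {ffun 'I_(arity f) -> sterm L})
    (i : {ffun 'I_(arity f) -> sort L}) (j : sort L) :
    (forall k, has_sort (ts k) (i k)) -> frank f i j -> has_sort (App f ts) j.

Fixpoint well_sorted (L : msl_sig)
    (A : form (var L) (funs L) (rels L)) : Prop :=
  match A with
  | Bot => True
  | Eq t u => exists i : sort L, has_sort t i /\ has_sort u i
  | Rel R ts => exists i : {ffun 'I_(arity R) -> sort L},
      (forall k, has_sort (ts k) (i k)) /\ rrank R i
  | And B C | Or B C | Imp B C => well_sorted B /\ well_sorted C
  | All _ B | Ex _ B => well_sorted B
  end.

Inductive msl_eq (L : msl_sig) : sform L -> Prop :=
| msl_eq_refl x : msl_eq (univ_closure (eq_refl_ax _ _ x))
| msl_eq_sym x y :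
    uniq [:: x; y] -> vsort x = vsort y ->
    msl_eq (univ_closure (eq_sym_ax _ _ x y))
| msl_eq_trans x y z :
    uniq [:: x; y; z] -> vsort x = vsort y -> vsort y = vsort z ->
    msl_eq (univ_closure (eq_trans_ax _ _ x y z))
| msl_eq_rel (R : rels L) (i : {ffun 'I_(arity R) -> sort L})
    (x y : {ffun 'I_(arity R) -> var L}) :
    rrank R i -> uniq (codom x ++ codom y) ->
    (forall k, vsort (x k) = i k) -> (forall k, vsort (y k) = i k) ->
    msl_eq (univ_closure (eq_rel_ax _ R x y))
| msl_eq_fun (f : funs L) (i : {ffun 'I_(arity f) -> sort L}) (j : sort L)
    (x y : {ffun 'I_(arity f) -> var L}) :
    frank f i j -> uniq (codom x ++ codom y) ->
    (forall k, vsort (x k) = i k) -> (forall k, vsort (y k) = i k) ->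
    msl_eq (univ_closure (eq_fun_ax _ f x y)).

Definition msl_derives (L : msl_sig) (T : sform L -> Prop) (A : sform L) :
    Prop :=
  exists2 G : seq (sform L),
    forall B, List.In B G -> T B \/ msl_eq B
    & nd (@well_sorted L) (fun x t => has_sort t (vsort x)) G A.

(* The unsorted signature of the translation: the relation symbols of [L]
   (left summand) and a fresh unary symbol Q_i for each sort (right summand).
   The unsorted variables are the variables of all sorts. *)

Definition urels (L : msl_sig) : alphabet :=
  @Alphabet (rels L + sort L)%type
    (fun s => match s with inl R => arity R | inr _ => 1 end).

Definition uform (L : msl_sig) := form (var L) (funs L) (urels L).

Definition Q (L : msl_sig) (i : sort L) (t : sterm L) : uform L :=
  @Rel (var L) (funs L) (urels L) (inr i) [ffun=> t].

Fixpoint tr (L : msl_sig) (A : form (var L) (funs L) (rels L)) : uform L :=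
  match A with
  | Bot => Bot
  | Eq t u => Eq t u
  | Rel R ts => @Rel (var L) (funs L) (urels L) (inl R) ts
  | And B C => And (tr B) (tr C)
  | Or B C => Or (tr B) (tr C)
  | Imp B C => Imp (tr B) (tr C)
  | All x B => All x (Imp (Q (vsort x) (Var x)) (tr B))
  | Ex x B => Ex x (And (Q (vsort x) (Var x)) (tr B))
  end.

Inductive J (L : msl_sig) : uform L -> Prop :=
| J_inh (i : sort L) x : J (univ_closure (Ex x (Q i (Var x))))
| J_fun (f : funs L) (i : {ffun 'I_(arity f) -> sort L}) (j : sort L)
    (x : {ffun 'I_(arity f) -> var L}) :
    frank f i j -> uniq (codom x) ->
    J (univ_closure
         (ImpAll [seq Q (i k) (Var (x k)) | k <- enum 'I_(arity f)]
                 (Q j (App f [ffun k => Var (x k)])))).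

(* In [Jplus_cover], the premises on [s] hold for some [s] only when the set
   of sorts is finite; [s] then lists it. *)
Inductive Jplus (L : msl_sig) : uform L -> Prop :=
| Jplus_J A : J A -> Jplus A
| Jplus_disj (i j : sort L) x :
    i != j -> Jplus (univ_closure (Imp (Q i (Var x)) (Neg (Q j (Var x)))))
| Jplus_strict (R : rels L) (i : {ffun 'I_(arity R) -> sort L})
    (x : {ffun 'I_(arity R) -> var L}) (k : 'I_(arity R)) :
    strict R i -> uniq (codom x) ->
    Jplus (univ_closure
             (Imp (@Rel (var L) (funs L) (urels L) (inl R)
                           [ffun l => Var (x l)])
                        (Q (i k) (Var (x k)))))
| Jplus_cover (s : seq (sort L)) x :
    uniq s -> (forall i, i \in s) ->
    Jplus (univ_closure (bigOr [seq Q i (Var x) | i <- s])).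

(* Main.v *)
(* From left to right, a sorted derivation is translated rule by rule, with
   the assumptions Q_i x for all variables x of sort i added; they serve to
   instantiate the relativized quantifiers, and in the end those that were
   used are discharged by the axioms [exists x, Q_i x].

   From right to left, suppose that phi is not derivable in the sorted logic.
   A Henkin completion of Gamma together with ~ phi gives a term model in which
   the sorts are disjoint, atomic formulas that are not well-sorted are false
   and ill-sorted applications take an arbitrary value.  Such a structure
   satisfies J^+, and tr A holds in it exactly when A is in the completion.
   By soundness of the unsorted logic, tr phi is then not derivable. *)

(* Substitution never renames bound variables, so each instantiation has to be shown free of
   capture. In the model this is settled once, by a finite set [S] of variables that no element may
   contain. The signature is not extended by constants: variables outside [S] serve as Henkin
   witnesses. There are always enough of them, because each sort has infinitely many variables, the
   theory consists of sentences, and a stage of the completion adds finitely many formulas. The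
   price is that quantifiers behave well only in formulas whose bound variables lie in [S]; this
   suffices because one unsorted derivation has finitely many premises.

   In the other direction the obstacle is the eigenvariable condition: an eigenvariable occurs free
   in its own assumption Q_i y. That assumption is therefore split off first, and it is exactly the
   guard of the relativized quantifier. *)
From mathcomp Require Import all_boot.
Require Import Defs.
From Stdlib Require Import Classical_Prop ClassicalEpsilon.

Set Implicit Arguments.
Unset Strict Implicit.
Unset Printing Implicit Defensive.

(** * Substitution *)

Section Syntax.

Variables (V : countType) (F P : alphabet).

Implicit Types (x y z : V) (t u : term V F) (A B : form V F P).
Implicit Type s : V -> term V F.

(** The nested fixpoint supplies induction hypotheses for the arguments stored inside the finite
    function. *)
Lemma term_ffun_ind (Pr : term V F -> Prop) :
  (forall x, Pr (Var x)) ->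
  (forall f (ts : {ffun 'I_(arity f) -> term V F}),
     (forall k, Pr (ts k)) -> Pr (App f ts)) ->
  forall t, Pr t.
Proof.
move=> hV hA; fix IH 1; case=> [x|f ts]; first exact: hV.
by apply: hA => k; apply: IH.
Qed.

Definition upd (D : Type) (s : V -> D) x (d : D) : V -> D :=
  fun z => if z == x then d else s z.

Fixpoint tssubst s t : term V F :=
  match t with
  | Var x => s x
  | App f ts => App f [ffun k => tssubst s (ts k)]
  end.

(** Simultaneous substitution, still without renaming; a binder only shields its own variable. It
    composes more easily than [subst], which is a special case, and it can apply a whole assignment
    of terms at once, as the truth lemma requires. *)
Fixpoint ssubst s A : form V F P :=
  match A with
  | Bot => Bot
  | Eq t u => Eq (tssubst s t) (tssubst s u)
  | Rel R ts => Rel R [ffun k => tssubst s (ts k)]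
  | And B C => And (ssubst s B) (ssubst s C)
  | Or B C => Or (ssubst s B) (ssubst s C)
  | Imp B C => Imp (ssubst s B) (ssubst s C)
  | All x B => All x (ssubst (upd s x (Var x)) B)
  | Ex x B => Ex x (ssubst (upd s x (Var x)) B)
  end.

Fixpoint bv A : seq V :=
  match A with
  | Bot | Eq _ _ | Rel _ _ => [::]
  | And B C | Or B C | Imp B C => bv B ++ bv C
  | All x B | Ex x B => x :: bv B
  end.

Lemma mem_tfvs n (ts : {ffun 'I_n -> term V F}) x :
  reflect (exists k, x \in tfv (ts k))
    (x \in flatten [seq tfv (ts k) | k <- enum 'I_n]).
Proof.
apply: (iffP flatten_mapP) => [[k _ hk]|[k hk]]; first by exists k.
by exists k => //; rewrite mem_enum.
Qed.

Lemma tssubst_ext s s' t :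
  {in tfv t, forall x, s x = s' x} -> tssubst s t = tssubst s' t.
Proof.
elim/term_ffun_ind: t => [x|f ts IH] /= h; first by apply: h; rewrite inE.
congr App; apply/ffunP => k; rewrite !ffunE; apply: IH => x hx.
by apply: h; apply/mem_tfvs; exists k.
Qed.

Lemma ssubst_ext s s' A :
  {in fv A, forall x, s x = s' x} -> ssubst s A = ssubst s' A.
Proof.
elim: A s s' => [|t u|R ts|B IHB C IHC|B IHB C IHC|B IHB C IHC|x B IHB|x B IHB]
  s s' //= h.
- by congr Eq; apply: tssubst_ext => x hx; apply: h; rewrite mem_cat hx ?orbT.
- congr Rel; apply/ffunP => k; rewrite !ffunE; apply: tssubst_ext => x hx.
  by apply: h; apply/mem_tfvs; exists k.
- by rewrite (IHB s s') 1?(IHC s s') // => x hx; apply: h;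
    rewrite mem_cat hx ?orbT.
- by rewrite (IHB s s') 1?(IHC s s') // => x hx; apply: h;
    rewrite mem_cat hx ?orbT.
- by rewrite (IHB s s') 1?(IHC s s') // => x hx; apply: h;
    rewrite mem_cat hx ?orbT.
- congr All; apply: IHB => z hz; rewrite /upd; case: eqP => // /eqP ne.
  by apply: h; rewrite mem_filter ne.
- congr Ex; apply: IHB => z hz; rewrite /upd; case: eqP => // /eqP ne.
  by apply: h; rewrite mem_filter ne.
Qed.

Lemma tssubst_id s t : {in tfv t, forall x, s x = Var x} -> tssubst s t = t.
Proof.
elim/term_ffun_ind: t => [x|f ts IH] /= h; first by apply: h; rewrite inE.
congr App; apply/ffunP => k; rewrite !ffunE; apply: IH => x hx.
by apply: h; apply/mem_tfvs; exists k.
Qed.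

Lemma ssubst_id s A : {in fv A, forall x, s x = Var x} -> ssubst s A = A.
Proof.
elim: A s => [|t u|R ts|B IHB C IHC|B IHB C IHC|B IHB C IHC|x B IHB|x B IHB]
  s //= h.
- by congr Eq; apply: tssubst_id => x hx; apply: h; rewrite mem_cat hx ?orbT.
- congr Rel; apply/ffunP => k; rewrite !ffunE; apply: tssubst_id => x hx.
  by apply: h; apply/mem_tfvs; exists k.
- by rewrite IHB ?IHC // => x hx; apply: h; rewrite mem_cat hx ?orbT.
- by rewrite IHB ?IHC // => x hx; apply: h; rewrite mem_cat hx ?orbT.
- by rewrite IHB ?IHC // => x hx; apply: h; rewrite mem_cat hx ?orbT.
- congr All; apply: IHB => z hz; rewrite /upd; case: eqP => [->//|/eqP ne].
  by apply: h; rewrite mem_filter ne.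
- congr Ex; apply: IHB => z hz; rewrite /upd; case: eqP => [->//|/eqP ne].
  by apply: h; rewrite mem_filter ne.
Qed.

Lemma tsubst_notin x t u : x \notin tfv u -> tsubst x t u = u.
Proof.
elim/term_ffun_ind: u => [y|f ts IH] /=; first by rewrite inE eq_sym; case: eqP.
move=> h; congr App; apply/ffunP => k; rewrite !ffunE; apply: IH.
by apply: contra h => h; apply/mem_tfvs; exists k.
Qed.

Lemma tsubst_tssubst s x t u :
  s x = Var x -> (forall z, z != x -> x \notin tfv (s z)) ->
  tsubst x t (tssubst s u) = tssubst (upd s x t) u.
Proof.
move=> hx hz; elim/term_ffun_ind: u => [y|f ts IH] /=.
  rewrite /upd; case: eqP => [->|/eqP ne]; first by rewrite hx /= eqxx.
  by apply: tsubst_notin; apply: hz.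
by congr App; apply/ffunP => k; rewrite !ffunE.
Qed.

(** The hypotheses say that [s] neither moves nor introduces [x], so the outer substitution meets
    exactly the original occurrences of [x]. No freeness condition is required: if a binder
    captures, it does so on both sides alike. *)
Lemma subst_ssubst s x t A :
  s x = Var x -> (forall z, z != x -> x \notin tfv (s z)) ->
  subst x t (ssubst s A) = ssubst (upd s x t) A.
Proof.
have quant s' y B :
    (forall s, s x = Var x -> (forall z, z != x -> x \notin tfv (s z)) ->
       subst x t (ssubst s B) = ssubst (upd s x t) B) ->
    s' x = Var x -> (forall z, z != x -> x \notin tfv (s' z)) ->
    (if y == x then ssubst (upd s' y (Var y)) B
     else subst x t (ssubst (upd s' y (Var y)) B)) =
    ssubst (upd (upd s' x t) y (Var y)) B.
  move=> IH hx hz; case: eqP => [->|/eqP ne].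
    by apply: ssubst_ext => z _; rewrite /upd; case: eqP.
  rewrite IH => [|//|z hzx].
  - apply: ssubst_ext => z _; rewrite /upd.
    by case: (eqVneq z x) => // ->; rewrite eq_sym (negbTE ne).
  - by rewrite /upd eq_sym (negbTE ne).
  - rewrite /upd; case: eqP => [_|_]; last exact: hz.
    by rewrite inE eq_sym.
elim: A s => [|u v|R ts|B IHB C IHC|B IHB C IHC|B IHB C IHC|y B IHB|y B IHB]
  s hx hz /=.
- by [].
- by rewrite !tsubst_tssubst.
- by congr Rel; apply/ffunP => k; rewrite !ffunE tsubst_tssubst.
- by rewrite IHB ?IHC.
- by rewrite IHB ?IHC.
- by rewrite IHB ?IHC.
- by rewrite quant.
- by rewrite quant.
Qed.

Lemma substE x t A : subst x t A = ssubst (upd Var x t) A.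
Proof.
rewrite -{1}(@ssubst_id Var A) // subst_ssubst // => z hz.
by rewrite inE eq_sym.
Qed.

Lemma subst_var x A : subst x (Var x) A = A.
Proof. by rewrite substE ssubst_id // => z _; rewrite /upd; case: eqP => // ->. Qed.

Lemma free_for_bv x t A : {in bv A, forall z, z \notin tfv t} -> free_for x t A.
Proof.
elim: A => [|u v|R ts|B IHB C IHC|B IHB C IHC|B IHB C IHC|y B IHB|y B IHB] //= h.
- by rewrite IHB ?IHC // => z hz; apply: h; rewrite mem_cat hz ?orbT.
- by rewrite IHB ?IHC // => z hz; apply: h; rewrite mem_cat hz ?orbT.
- by rewrite IHB ?IHC // => z hz; apply: h; rewrite mem_cat hz ?orbT.
- rewrite h ?inE ?eqxx // IHB ?orbT // => z hz.
  by apply: h; rewrite inE hz orbT.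
- rewrite h ?inE ?eqxx // IHB ?orbT // => z hz.
  by apply: h; rewrite inE hz orbT.
Qed.

Lemma free_for_var x A : free_for x (Var x) A.
Proof.
elim: A => [|u v|R ts|B IHB C IHC|B IHB C IHC|B IHB C IHC|y B IHB|y B IHB] //=;
  rewrite ?IHB ?IHC //.
- by rewrite mem_filter inE eq_sym; case: eqP; rewrite ?orbT.
- by rewrite mem_filter inE eq_sym; case: eqP; rewrite ?orbT.
Qed.

Lemma bv_ssubst s A : bv (ssubst s A) = bv A.
Proof.
by elim: A s => [|u v|R ts|B IHB C IHC|B IHB C IHC|B IHB C IHC|y B IHB|y B IHB]
  s //=; rewrite ?IHB ?IHC.
Qed.

Lemma bv_All xs A : bv (foldr (@All V F P) A xs) = xs ++ bv A.
Proof. by elim: xs => //= x xs ->. Qed.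

Lemma fv_All xs A :
  fv (foldr (@All V F P) A xs) = [seq y <- fv A | y \notin xs].
Proof.
elim: xs => [|x xs IH] /=; first by rewrite filter_predT.
rewrite IH -filter_predI; apply: eq_filter => y /=.
by rewrite inE negb_or.
Qed.

Lemma univ_closure_sentence A : sentence (univ_closure A).
Proof.
rewrite /sentence /univ_closure fv_All -[RHS](filter_pred0 (fv A)).
by apply: eq_in_filter => y hy; rewrite mem_undup hy.
Qed.

Lemma univ_closure_id A : sentence A -> univ_closure A = A.
Proof. by rewrite /univ_closure => ->. Qed.

Lemma ssubst_sentence s A : sentence A -> ssubst s A = A.
Proof. by move=> hA; apply: ssubst_id => x; rewrite hA. Qed.

Lemma ssubst_bigAnd s (l : seq (form V F P)) :
  ssubst s (bigAnd l) = bigAnd [seq ssubst s A | A <- l].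
Proof. by elim: l => //= A [|B l] //= ->. Qed.

Lemma ssubst_ImpAll s (l : seq (form V F P)) B :
  ssubst s (ImpAll l B) = ImpAll [seq ssubst s A | A <- l] (ssubst s B).
Proof. by case: l => //= A l; rewrite -/(bigAnd (A :: l)) ssubst_bigAnd. Qed.

Lemma bv_ImpAll (l : seq (form V F P)) B :
  (forall A, List.In A l -> bv A = [::]) -> bv B = [::] -> bv (ImpAll l B) = [::].
Proof.
case: l => //= A l hl ->; rewrite cats0.
elim: l A hl => [|B' l IH] A hl /=; first by apply: hl; left.
rewrite hl /=; last by left.
by apply: IH => C hC; apply: hl; right.
Qed.

(** * Semantics *)

Section Semantics.

(* Equality is interpreted by an arbitrary relation, so that the term model
   below need not be a quotient. *)
Variables (D : Type) (fI : forall f : F, {ffun 'I_(arity f) -> D} -> D).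
Variables (eI : D -> D -> Prop) (rI : forall R : P, {ffun 'I_(arity R) -> D} -> Prop).

Implicit Type r : V -> D.

Fixpoint eval r t : D :=
  match t with
  | Var x => r x
  | App f ts => fI [ffun k => eval r (ts k)]
  end.

Fixpoint sat r A : Prop :=
  match A with
  | Bot => False
  | Eq t u => eI (eval r t) (eval r u)
  | Rel R ts => rI [ffun k => eval r (ts k)]
  | And B C => sat r B /\ sat r C
  | Or B C => sat r B \/ sat r C
  | Imp B C => sat r B -> sat r C
  | All x B => forall d, sat (upd r x d) B
  | Ex x B => exists d, sat (upd r x d) B
  end.

Lemma eval_ext r r' t : {in tfv t, forall x, r x = r' x} -> eval r t = eval r' t.
Proof.
elim/term_ffun_ind: t => [x|f ts IH] /= h; first by apply: h; rewrite inE.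
congr fI; apply/ffunP => k; rewrite !ffunE; apply: IH => x hx.
by apply: h; apply/mem_tfvs; exists k.
Qed.

Lemma sat_ext r r' A : {in fv A, forall x, r x = r' x} -> sat r A <-> sat r' A.
Proof.
have quant r1 r2 x B :
    (forall r r', {in fv B, forall x, r x = r' x} -> sat r B <-> sat r' B) ->
    {in [seq y <- fv B | y != x], forall x, r1 x = r2 x} ->
    forall d, sat (upd r1 x d) B <-> sat (upd r2 x d) B.
  move=> IH h d; apply: IH => z hz; rewrite /upd; case: eqP => // /eqP ne.
  by apply: h; rewrite mem_filter ne.
elim: A r r' => [|t u|R ts|B IHB C IHC|B IHB C IHC|B IHB C IHC|x B IHB|x B IHB]
  r r' //= h.
- by rewrite !(@eval_ext r r') // => x hx; apply: h; rewrite mem_cat hx ?orbT.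
- rewrite (_ : [ffun k => eval r (ts k)] = [ffun k => eval r' (ts k)]) //.
  apply/ffunP => k; rewrite !ffunE; apply: eval_ext => x hx.
  by apply: h; apply/mem_tfvs; exists k.
- by rewrite (IHB r r') 1?(IHC r r') // => x hx; apply: h;
    rewrite mem_cat hx ?orbT.
- by rewrite (IHB r r') 1?(IHC r r') // => x hx; apply: h;
    rewrite mem_cat hx ?orbT.
- by rewrite (IHB r r') 1?(IHC r r') // => x hx; apply: h;
    rewrite mem_cat hx ?orbT.
- have q := quant _ _ _ _ IHB h.
  by split=> hd d; apply/q.
- have q := quant _ _ _ _ IHB h.
  by split=> -[d hd]; exists d; apply/q.
Qed.

Lemma sat_notin r x d A : x \notin fv A -> sat (upd r x d) A <-> sat r A.
Proof.
move=> hx; apply: sat_ext => z hz; rewrite /upd; case: eqP => // e.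
by rewrite -e hz in hx.
Qed.

Lemma eval_tsubst r x t u :
  eval r (tsubst x t u) = eval (upd r x (eval r t)) u.
Proof.
elim/term_ffun_ind: u => [y|f ts IH] /=; first by rewrite /upd; case: eqP.
by congr fI; apply/ffunP => k; rewrite !ffunE.
Qed.

Lemma sat_subst r x t A :
  free_for x t A -> sat r (subst x t A) <-> sat (upd r x (eval r t)) A.
Proof.
(* A binder for [x] itself blocks the substitution; if [x] is free below another binder [y], then
   [y] is not in [t] and updating [y] leaves the value of [t] unchanged; if [x] is not free, the
   substitution is the identity. *)
have quant y B d r' :
    (forall r, free_for x t B ->
       sat r (subst x t B) <-> sat (upd r x (eval r t)) B) ->
    (x \notin [seq z <- fv B | z != y]) || (y \notin tfv t) && free_for x t B ->
    sat (upd r' y d) (if y == x then B else subst x t B) <->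
    sat (upd (upd r' x (eval r' t)) y d) B.
  move=> IH; rewrite mem_filter; case: (eqVneq y x) => [-> _|ne].
    by apply: sat_ext => z _; rewrite /upd; case: eqP.
  case: (boolP (x \in fv B)) => /= [_ /andP [yt ff]|xB _].
    rewrite IH //.
    rewrite (@eval_ext (upd r' y d) r') => [|z hz]; last first.
      by rewrite /upd; case: eqP => // e; rewrite -e hz in yt.
    apply: sat_ext => z _; rewrite /upd.
    by case: (eqVneq z x) => // ->; rewrite eq_sym (negbTE ne).
  have ->: subst x t B = B.
    rewrite substE ssubst_id // => z hz; rewrite /upd; case: eqP => // e.
    by rewrite -e hz in xB.
  apply: sat_ext => z hz; rewrite /upd.
  by case: (eqVneq z x) => // e; rewrite -e hz in xB.
elim: A r => [|u v|R ts|B IHB C IHC|B IHB C IHC|B IHB C IHC|y B IHB|y B IHB]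
  r //=.
- by rewrite !eval_tsubst.
- rewrite (_ : [ffun k => eval r ([ffun k0 => tsubst x t (ts k0)] k)] =
    [ffun k => eval (upd r x (eval r t)) (ts k)]) //.
  by apply/ffunP => k; rewrite !ffunE eval_tsubst.
- by case/andP => hB hC; rewrite IHB ?IHC.
- by case/andP => hB hC; rewrite IHB ?IHC.
- by case/andP => hB hC; rewrite IHB ?IHC.
- by move=> h; split=> hd d; [rewrite -quant|rewrite quant].
- by move=> h; split=> -[d hd]; exists d; [rewrite -quant|rewrite quant].
Qed.

(** The semantic form of the eigenvariable condition: a value given to [y] can be handed back to
    [x], since [A] does not see [y] unless [y] is [x]. *)
Lemma sat_eigen r x y d A :
  free_for x (Var y) A -> y = x \/ y \notin fv A ->
  sat (upd r y d) (subst x (Var y) A) <-> sat (upd r x d) A.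
Proof.
move=> ff hy; rewrite sat_subst //= [upd r y d y]/upd eqxx.
apply: sat_ext => z hz; rewrite /upd; case: eqP => // ne; case: eqP => // e.
by case: hy => hy; [rewrite -hy e in ne|rewrite -e hz in hy].
Qed.

(** No rule mentions equality, which enters only through axioms, so any [eI] is allowed. The
    parameters [wf] and [inst] merely restrict derivations, so one proof covers both calculi. *)
Lemma nd_sound wf inst G A :
  nd wf inst G A -> forall r, (forall B, List.In B G -> sat r B) -> sat r A.
Proof.
elim=> {G A}.
- by move=> G A _ hA r; apply.
- by move=> G G' A hG _ IH r h; apply: IH => B hB; apply/h/hG.
- move=> G A _ _ IH r h; apply: NNPP => nA.
  by apply: (IH r) => B [<-|/h].
- by move=> G A B _ IA _ IB r h; split; [apply: IA|apply: IB].
- by move=> G A B _ IH r h; case: (IH r h).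
- by move=> G A B _ IH r h; case: (IH r h).
- by move=> G A B _ _ IH r h; left; apply: IH.
- by move=> G A B _ _ IH r h; right; apply: IH.
- move=> G A B C _ IH _ IA _ IB r h.
  by case: (IH r h) => [hA|hB]; [apply: IA|apply: IB] => E [<-|/h].
- by move=> G A B _ _ IH r h hA; apply: IH => E [<-|/h].
- by move=> G A B _ IAB _ IA r h; apply: IAB (IA r h).
- move=> G x y A _ _ [ff hy hG] _ IH r h d.
  apply/(sat_eigen r d ff hy); apply: IH => B hB.
  by apply/sat_notin; [apply: hG|apply: h].
- by move=> G x t A _ ff _ IH r h; apply/sat_subst => //; apply: IH.
- move=> G x t A _ _ ff _ IH r h; exists (eval r t).
  by apply/sat_subst => //; apply: IH.
- move=> G x y A C _ [ff hy hG] _ IE _ IC r h.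
  have [d hd] := IE r h.
  apply/(@sat_notin r y d); first by apply: hG; left.
  apply: IC => B [<-|hB]; first by apply/sat_eigen.
  by apply/sat_notin; [apply: hG; right|apply: h].
Qed.

Lemma sat_univ_closure r A : (forall r, sat r A) -> sat r (univ_closure A).
Proof.
by move=> hA; rewrite /univ_closure; elim: (undup _) r => //= x xs IH r d.
Qed.

Lemma sat_bigAnd r (l : seq (form V F P)) :
  sat r (bigAnd l) <-> forall B, List.In B l -> sat r B.
Proof.
elim: l => [|A [|A' l] IH]; first by split=> [_ B []|_ []].
  by split=> [h B [<-|[]] //|h]; apply: h; left.
split=> [[hA /IH hl] B [<-|/hl]|h] //.
split; first by apply: h; left.
by apply/IH => B hB; apply: h; right.
Qed.

Lemma sat_ImpAll r (l : seq (form V F P)) B :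
  ((forall A, List.In A l -> sat r A) -> sat r B) -> sat r (ImpAll l B).
Proof.
by case: l => [|A l] h; [apply: h|move/sat_bigAnd => hl; apply: h].
Qed.

Lemma sat_bigOr r (l : seq (form V F P)) A :
  List.In A l -> sat r A -> sat r (bigOr l).
Proof.
elim: l => // B [|B' l] IH; first by case=> [->|[]].
by case=> [->|hA] h; [left|right; apply: IH].
Qed.

End Semantics.

End Syntax.

Lemma In_map (T U : Type) (g : T -> U) (l : seq T) b :
  List.In b [seq g a | a <- l] <-> exists2 a, List.In a l & b = g a.
Proof.
elim: l => [|a l IH] /=; first by split=> // -[].
split=> [[<-|/IH [a' h ->]]|[a' [<- ->|h e]]].
- by exists a; first left.
- by exists a'; first right.
- by left.
- by right; apply/IH; exists a'.
Qed.

Lemma In_mem (T : eqType) (l : seq T) a : List.In a l <-> a \in l.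
Proof.
elim: l => //= b l IH; rewrite inE IH; split=> [[->|->]|/orP [/eqP ->|]].
- by rewrite eqxx.
- by rewrite orbT.
- by left.
- by right.
Qed.

(** * Derivability from sets of formulas *)

Section Derivability.

Variables (V : countType) (F P : alphabet).
Variables (wf : form V F P -> Prop) (inst : V -> term V F -> Prop).

Implicit Types (A B C : form V F P) (T U : form V F P -> Prop).

(** Both [msl_derives] and [fol_derives] unfold to instances of this, with the equality axioms
    joined to the theory. *)
Definition der T A : Prop :=
  exists2 G, forall B, List.In B G -> T B & nd wf inst G A.

Definition add A T : form V F P -> Prop := fun B => B = A \/ T B.

Lemma list_add A T (G : seq (form V F P)) :
  (forall B, List.In B G -> add A T B) ->
  exists2 G', forall B, List.In B G' -> T B
            & forall B, List.In B G -> List.In B (A :: G').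
Proof.
elim: G => [|C G IH] h; first by exists [::] => B [].
have [|G' hG' sG] := IH; first by move=> B hB; apply: h; right.
have [e|hC] := h C (or_introl erefl).
  by exists G' => // B [<-|/sG //]; left.
exists (C :: G') => [B [<- //|/hG' //]|B [<-|/sG [<-|hB]]].
- by right; left.
- by left.
- by right; right.
Qed.

Lemma der_mono T U A : (forall B, T B -> U B) -> der T A -> der U A.
Proof. by move=> h [G hG d]; exists G => // B /hG /h. Qed.

Lemma der_ass T A : wf A -> T A -> der T A.
Proof.
by move=> wA hA; exists [:: A] => [B [<-|[]] //|]; apply: nd_ass => //; left.
Qed.

Lemma der_add T A B : der T B -> der (add A T) B.
Proof. by apply: der_mono => C; right. Qed.

(** Transfers a rule that discharges an assumption from lists to sets: [list_add] first gathers the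
    occurrences of [A] at the head of the list. *)
Lemma der_lift1 T A B C :
  (forall G, nd wf inst (A :: G) B -> nd wf inst G C) ->
  der (add A T) B -> der T C.
Proof.
move=> h [G /list_add [G' hG' sG] d]; exists G' => //.
by apply: h; apply: nd_weak d.
Qed.

Lemma der_lift2 T A B C :
  (forall G, nd wf inst G A -> nd wf inst G B -> nd wf inst G C) ->
  der T A -> der T B -> der T C.
Proof.
move=> h [G hG dA] [G' hG' dB]; exists (G ++ G').
  by move=> E /(@List.in_app_or _ G G') [/hG|/hG'].
apply: h; [apply: nd_weak dA => E hE|apply: nd_weak dB => E hE].
- by apply: (@List.in_or_app _ G G'); left.
- by apply: (@List.in_or_app _ G G'); right.
Qed.

Lemma der_impI T A B : wf A -> der (add A T) B -> der T (Imp A B).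
Proof. by move=> wA; apply: der_lift1 => G; apply: nd_impI. Qed.

Lemma der_raa T A : wf A -> der (add (Neg A) T) Bot -> der T A.
Proof. by move=> wA; apply: der_lift1 => G; apply: nd_raa. Qed.

Lemma der_impE T A B : der T (Imp A B) -> der T A -> der T B.
Proof. by apply: der_lift2 => G; apply: nd_impE. Qed.

Lemma der_cut T A B : wf A -> der T A -> der (add A T) B -> der T B.
Proof. by move=> wA dA dB; apply: der_impE dA; apply: der_impI. Qed.

Lemma der_andI T A B : der T A -> der T B -> der T (And A B).
Proof. by apply: der_lift2 => G; apply: nd_andI. Qed.

Lemma der_andE1 T A B : der T (And A B) -> der T A.
Proof. by case=> G hG d; exists G => //; apply: nd_andE1 d. Qed.

Lemma der_andE2 T A B : der T (And A B) -> der T B.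
Proof. by case=> G hG d; exists G => //; apply: nd_andE2 d. Qed.

Lemma der_orI1 T A B : wf B -> der T A -> der T (Or A B).
Proof. by move=> wB [G hG d]; exists G => //; apply: nd_orI1. Qed.

Lemma der_orI2 T A B : wf A -> der T B -> der T (Or A B).
Proof. by move=> wA [G hG d]; exists G => //; apply: nd_orI2. Qed.

(** The three premises use different finite lists. Closing the two minor ones into implications and
    pairing them leaves only two lists for [der_lift2] to merge. *)
Lemma der_orE T A B C : wf A -> wf B ->
  der T (Or A B) -> der (add A T) C -> der (add B T) C -> der T C.
Proof.
move=> wA wB dAB /(der_impI wA) dA /(der_impI wB) dB.
apply: der_lift2 dAB (der_andI dA dB) => G dAB dC.
have sG E : List.In E G -> forall B, List.In E (B :: G) by right.
apply: nd_orE dAB _ _.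
- apply: (@nd_impE _ _ _ _ _ _ A); last by apply: nd_ass => //; left.
  by apply: nd_andE1; apply: nd_weak dC => E /sG.
- apply: (@nd_impE _ _ _ _ _ _ B); last by apply: nd_ass => //; left.
  by apply: nd_andE2; apply: nd_weak dC => E /sG.
Qed.

Lemma der_bot T A : wf A -> der T Bot -> der T A.
Proof. by move=> wA /(der_add (Neg A)); apply: der_raa. Qed.

Lemma der_allI T x y A :
  wf (All x A) -> inst x (Var y) -> free_for x (Var y) A ->
  y = x \/ y \notin fv A -> (forall B, T B -> y \notin fv B) ->
  der T (subst x (Var y) A) -> der T (All x A).
Proof.
move=> wA iy ff hy hT [G hG d]; exists G => //.
by apply: (@nd_allI _ _ _ _ _ _ _ y) => //; split=> // B /hG /hT.
Qed.

Lemma der_allE T x t A :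
  inst x t -> free_for x t A -> der T (All x A) -> der T (subst x t A).
Proof. by move=> it ff [G hG d]; exists G => //; apply: nd_allE. Qed.

Lemma der_exI T x t A :
  wf (Ex x A) -> inst x t -> free_for x t A -> der T (subst x t A) ->
  der T (Ex x A).
Proof. by move=> wA it ff [G hG d]; exists G => //; apply: nd_exI d. Qed.

Lemma der_exE T x y A C :
  wf (subst x (Var y) A) ->
  inst x (Var y) -> free_for x (Var y) A -> y = x \/ y \notin fv A ->
  (forall B, T B -> y \notin fv B) -> y \notin fv C ->
  der T (Ex x A) -> der (add (subst x (Var y) A) T) C -> der T C.
Proof.
move=> wA iy ff hy hT hC [G hG d] [G' /list_add [G1 hG1 sG'] d'].
exists (G ++ G1); first by move=> E /(@List.in_app_or _ G G1) [/hG|/hG1].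
apply: (@nd_exE _ _ _ _ _ _ x y A) => //.
- split=> // B [<- //|/(@List.in_app_or _ G G1) [/hG|/hG1]]; exact: hT.
- by apply: nd_weak d => E hE; apply: (@List.in_or_app _ G G1); left.
- apply: nd_weak d' => E /sG' [->|hE]; first by left.
  by right; apply: (@List.in_or_app _ G G1); right.
Qed.

Lemma der_trans T U A :
  (forall B, U B -> wf B /\ der T B) -> der U A -> der T A.
Proof.
move=> hU [G hG d].
(* Mixing the finitely many used members of [U] with [T] lets them be cut away one at a time. *)
have {d}: der (fun B => List.In B G \/ T B) A by exists G => // B; left.
elim: G hG => [|B G IH] hG; first by apply: der_mono => B [[]|].
move=> d; apply: IH => [C hC|]; first by apply: hG; right.
have [wB dB] := hU B (hG B (or_introl erefl)).
apply: (der_cut wB); first by apply: der_mono dB; right.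
by apply: der_mono d => C [[<-|hC]|hC]; [left|right; left|right; right].
Qed.

(* The closed variables are instantiated one at a time; since no [s x]
   contains a variable still to be instantiated, this amounts to a
   simultaneous substitution. *)
Lemma der_closure_inst T A s :
  bv A = [::] -> {in fv A, forall x, inst x (s x)} ->
  {in fv A &, forall x y, y \notin tfv (s x)} ->
  der T (univ_closure A) -> der T (ssubst s A).
Proof.
move=> qA his hs; rewrite /univ_closure.
(* [part ys] is [s] restricted to the variables already instantiated; the induction moves the head
   of the quantifier prefix into [ys]. *)
pose part (ys : seq V) z := if z \in ys then s z else Var z.
rewrite -{1}[A](@ssubst_id _ _ _ (part [::])) //.
have ->: ssubst s A = ssubst (part (rev (undup (fv A)) ++ [::])) A.
  by apply: ssubst_ext => z hz; rewrite /part cats0 mem_rev mem_undup hz.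
have: uniq (undup (fv A) ++ [::]) by rewrite cats0 undup_uniq.
have: {subset undup (fv A) ++ [::] <= fv A}.
  by move=> z; rewrite cats0 mem_undup.
elim: (undup (fv A)) [::] => [|x xs IH] ys //= sub /andP [xn uxs] d.
rewrite rev_cons cat_rcons; apply: IH.
- move=> z; rewrite mem_cat inE => hz; apply: sub.
  by rewrite inE mem_cat orbCA.
- move: uxs; rewrite !cat_uniq /= => /and3P [-> /hasPn hxy ->].
  move: xn; rewrite mem_cat negb_or => /andP [xxs ->]; rewrite !andbT /= negb_or xxs.
  by apply/hasPn.
have hx : x \in fv A by apply: sub; rewrite inE eqxx.
have xA z : z \in xs -> z \in fv A.
  by move=> hz; apply: sub; rewrite inE mem_cat hz orbT.
have := der_allE (his x hx) _ d.
have -> : subst x (s x) (foldr (@All V F P) (ssubst (part ys) A) xs) =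
    foldr (@All V F P) (ssubst (part (x :: ys)) A) xs.
  move: xn; rewrite mem_cat negb_or => /andP [xxs xys].
  have ysA z : z \in ys -> z \in fv A.
    by move=> hz; apply: sub; rewrite inE mem_cat hz !orbT.
  elim: xs xxs {sub uxs d xA} => [_|z xs IH] /=.
    rewrite subst_ssubst.
    - by apply: ssubst_ext => z _; rewrite /upd /part inE; case: eqP => [->|].
    - by rewrite /part (negbTE xys).
    - move=> z zx; rewrite /part; case: ifP => zys.
        by apply: hs => //; apply: ysA.
      by rewrite inE eq_sym.
  by rewrite inE negb_or eq_sym => /andP [/negbTE -> /IH ->].
apply; apply: free_for_bv => z; rewrite bv_All bv_ssubst qA cats0 => /xA hz.
exact: hs.
Qed.

End Derivability.

(** * Fresh variables and instances of the axioms *)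

Section Instances.

Variables (V : countType) (F P : alphabet).

Lemma mem_fv_ImpAll (l : seq (form V F P)) B x :
  x \in fv (ImpAll l B) ->
  (exists2 A, List.In A l & x \in fv A) \/ x \in fv B.
Proof.
case: l => [|A l]; first by right.
rewrite /ImpAll [fv _]/(fv (bigAnd (A :: l)) ++ fv B) mem_cat.
case/orP => hx; last by right.
left; elim: l A hx => [|A' l IH] A; first by exists A => //; left.
rewrite [fv _]/(fv A ++ fv (bigAnd (A' :: l))) mem_cat => /orP [hx|/IH [C hC hx]].
- by exists A => //; left.
- by exists C => //; right.
Qed.

Lemma der_ImpAll (wf : form V F P -> Prop) inst T (l : seq (form V F P)) B :
  der wf inst T (ImpAll l B) -> (forall A, List.In A l -> der wf inst T A) ->
  der wf inst T B.
Proof.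
case: l => [|A l] // h hl; apply: der_impE h _.
elim: l A hl => [|A' l IH] A hl; first by apply: hl; left.
apply: (der_andI (hl A _)); first by left.
by apply: IH => C hC; apply: hl; right.
Qed.

(** Keeping [s] off the tuple allows two such extensions to be chained, one for each side of a
    congruence axiom. *)
Lemma ffun_of_inj n (T : Type) (x : {ffun 'I_n -> V}) (t : {ffun 'I_n -> T})
    (s : V -> T) :
  uniq (codom x) ->
  exists s', (forall k, s' (x k) = t k) /\ {in [predC codom x], s' =1 s}.
Proof.
move=> /injectiveP xi.
exists (fun z => if [pick k | x k == z] is Some k then t k else s z).
split=> [k|z zx].
  by case: pickP => [k' /eqP /xi -> //|/(_ k)]; rewrite eqxx.
case: pickP => // k /eqP e.
by case/negP: zx; rewrite -e codom_f.
Qed.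

End Instances.

Section Sorted.

Variable L : msl_sig.

Implicit Types (A B C : sform L) (t u : sterm L) (T : sform L -> Prop).

Lemma fresh_seq (l : seq (sort L)) (s : seq (var L)) :
  exists xs, [/\ uniq xs, map (@vsort L) xs = l & {in xs, forall x, x \notin s}].
Proof.
elim: l => [|i l [xs [uxs <- hxs]]]; first by exists [::].
have [x xi] := var_inf i (s ++ xs); rewrite mem_cat negb_or => /andP [xns xnx].
exists (x :: xs); split; first by rewrite /= xnx.
  by rewrite /= xi.
by move=> z; rewrite inE => /orP [/eqP -> //|/hxs].
Qed.

Lemma fresh_ffun n (i : {ffun 'I_n -> sort L}) (s : seq (var L)) :
  exists x : {ffun 'I_n -> var L},
    [/\ uniq (codom x), forall k, vsort (x k) = i k & forall k, x k \notin s].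
Proof.
have [i0] := sort_inh L; have [x0 _ _] := var_inf i0 [::].
have [xs [uxs exs hxs]] := fresh_seq (codom i) s.
have sxs : size xs = n by rewrite -(size_map (@vsort L)) exs size_codom card_ord.
exists [ffun k : 'I_n => nth x0 xs k].
have ec : codom [ffun k : 'I_n => nth x0 xs k] = xs.
  apply: (@eq_from_nth _ x0); first by rewrite size_codom card_ord.
  move=> k; rewrite size_codom card_ord => kn.
  rewrite codomE (nth_map (Ordinal kn)) ?size_enum_ord // ffunE.
  by rewrite nth_enum_ord.
split=> [|k|k]; first by rewrite ec.
  rewrite ffunE -(nth_map x0 (i k)) ?sxs // exs codomE.
  by rewrite (nth_map k) ?size_enum_ord // nth_ord_enum.
by rewrite ffunE; apply: hxs; rewrite mem_nth // sxs.
Qed.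

Lemma fresh_ffun2 n (i : {ffun 'I_n -> sort L}) (s : seq (var L)) :
  exists x y : {ffun 'I_n -> var L},
    [/\ uniq (codom x ++ codom y), forall k, vsort (x k) = i k,
        forall k, vsort (y k) = i k, forall k, x k \notin s
      & forall k, y k \notin s].
Proof.
have [x [ux xi xs]] := fresh_ffun i s.
have [y [uy yi ys]] := fresh_ffun i (s ++ codom x).
exists x, y; split=> // [|k]; last first.
  by have := ys k; rewrite mem_cat negb_or => /andP [].
rewrite cat_uniq ux uy andbT /=; apply/hasPn => z /codomP [k ->].
by have := ys k; rewrite mem_cat negb_or => /andP [].
Qed.


(** * Sorts of terms and formulas under substitution *)

Lemma has_sort_var_inv x i : has_sort (Var x : sterm L) i -> vsort x = i.
Proof. by move=> h; inversion h. Qed.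

Lemma has_sort_app_inv (f : funs L) (ts : {ffun 'I_(arity f) -> sterm L}) j :
  has_sort (App f ts) j ->
  exists2 i : {ffun 'I_(arity f) -> sort L},
    forall k, has_sort (ts k) (i k) & frank f i j.
Proof.
move=> h.
(* The type of [ts] depends on [f], so plain inversion would leave equalities of dependent pairs;
   matching inside the motive avoids them. *)
pose G (t : sterm L) j := if t is App f ts then
  exists2 i : {ffun 'I_(arity f) -> sort L},
    forall k, has_sort (ts k) (i k) & frank f i j else True.
suff: G (App f ts) j by [].
by case: h => // f' ts' i j' hs hf; exists i.
Qed.

(** By induction the arguments determine the tuple of input sorts, and a rank is a partial function.
    This is what makes the sorts of the term model disjoint. *)
Lemma has_sort_uniq t i j : has_sort t i -> has_sort t j -> i = j.
Proof.
elim/term_ffun_ind: t i j => [x|f ts IH] i j.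
  by move=> /has_sort_var_inv <- /has_sort_var_inv <-.
move=> /has_sort_app_inv [a ha fa] /has_sort_app_inv [b hb fb].
have e : a = b by apply/ffunP => k; apply: IH.
by rewrite -e in fb; apply: frank_fun fa fb.
Qed.

Lemma has_sort_tssubst (s : var L -> sterm L) t i :
  {in tfv t, forall x, has_sort (s x) (vsort x)} -> has_sort t i ->
  has_sort (tssubst s t) i.
Proof.
elim/term_ffun_ind: t i => [x|f ts IH] i hs.
  by move=> /has_sort_var_inv <-; apply: hs; rewrite inE.
move=> /has_sort_app_inv [a ha fa] /=; apply: has_sort_app fa => k.
rewrite ffunE; apply: IH => // x hx.
by apply: hs; apply/mem_tfvs; exists k.
Qed.

Lemma well_sorted_ssubst (s : var L -> sterm L) A :
  {in fv A, forall x, has_sort (s x) (vsort x)} -> well_sorted A ->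
  well_sorted (ssubst s A).
Proof.
elim: A s => [|t u|R ts|B IHB C IHC|B IHB C IHC|B IHB C IHC|x B IHB|x B IHB]
  s //= hs.
- move=> [i [ht hu]]; exists i.
  by split; apply: has_sort_tssubst => // x hx; apply: hs;
    rewrite mem_cat hx ?orbT.
- move=> [i [hi ri]]; exists i; split=> // k; rewrite ffunE.
  by apply: has_sort_tssubst => // x hx; apply: hs; apply/mem_tfvs; exists k.
- by case=> wB wC; split; [apply: IHB|apply: IHC] => // x hx; apply: hs;
    rewrite mem_cat hx ?orbT.
- by case=> wB wC; split; [apply: IHB|apply: IHC] => // x hx; apply: hs;
    rewrite mem_cat hx ?orbT.
- by case=> wB wC; split; [apply: IHB|apply: IHC] => // x hx; apply: hs;
    rewrite mem_cat hx ?orbT.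
- apply: IHB => z hz; rewrite /upd; case: eqP => [->|/eqP ne].
    exact: has_sort_var.
  by apply: hs; rewrite mem_filter ne.
- apply: IHB => z hz; rewrite /upd; case: eqP => [->|/eqP ne].
    exact: has_sort_var.
  by apply: hs; rewrite mem_filter ne.
Qed.

Lemma well_sorted_subst x t A :
  has_sort t (vsort x) -> well_sorted A -> well_sorted (subst x t A).
Proof.
move=> ht wA; rewrite substE; apply: well_sorted_ssubst => // z _.
by rewrite /upd; case: eqP => [-> //|_]; apply: has_sort_var.
Qed.

Lemma well_sorted_univ_closure A : well_sorted A -> well_sorted (univ_closure A).
Proof. by rewrite /univ_closure; elim: (undup _). Qed.

Lemma well_sorted_ImpAll (l : seq (sform L)) B :
  (forall A, List.In A l -> well_sorted A) -> well_sorted B ->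
  well_sorted (ImpAll l B).
Proof.
case: l => // A l hl hB; split=> //.
elim: l A hl => [|A' l IH] A hl; first by apply: hl; left.
split; first by apply: hl; left.
by apply: IH => C hC; apply: hl; right.
Qed.

(** * From many-sorted to unsorted derivations *)

Local Notation uder := (@der _ _ (urels L) (fun _ => True) (fun _ _ => True)).

Definition Qv (x : var L) : uform L := Q (vsort x) (Var x).

Lemma fv_Q (i : sort L) t : fv (Q i t) = tfv t.
Proof. by rewrite /= enum_ordSl /= ffunE enum_ord0 /= cats0. Qed.

Lemma Q_ssubst s (i : sort L) t : ssubst s (Q i t) = Q i (tssubst s t).
Proof. by rewrite /Q /=; congr Rel; apply/ffunP => k; rewrite !ffunE. Qed.

Lemma Q_subst x t (i : sort L) u : subst x t (Q i u) = Q i (tsubst x t u).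
Proof. by rewrite /Q /=; congr Rel; apply/ffunP => k; rewrite !ffunE. Qed.

Lemma Qv_subst x t : subst x t (Qv x) = Q (vsort x) t.
Proof. by rewrite Q_subst /= eqxx. Qed.

Lemma fv_tr A : fv (tr A) = fv A.
Proof.
elim: A => [|t u|R ts|B IHB C IHC|B IHB C IHC|B IHB C IHC|x B IHB|x B IHB] //=;
  rewrite ?IHB ?IHC //.
- by rewrite -[flatten _]/(fv (Qv x)) fv_Q /= eqxx.
- by rewrite -[flatten _]/(fv (Qv x)) fv_Q /= eqxx.
Qed.

Lemma tr_subst x t A : tr (subst x t A) = subst x t (tr A).
Proof.
elim: A => [|u v|R ts|B IHB C IHC|B IHB C IHC|B IHB C IHC|y B IHB|y B IHB] //=;
  rewrite ?IHB ?IHC //.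
- congr All; case: (eqVneq y x) => // ne.
  by rewrite IHB -[Rel _ [ffun _ => _]]/(subst x t (Qv y)) Q_subst /= (negbTE ne).
- congr Ex; case: (eqVneq y x) => // ne.
  by rewrite IHB -[Rel _ [ffun _ => _]]/(subst x t (Qv y)) Q_subst /= (negbTE ne).
Qed.

Lemma free_for_tr x t A : free_for x t (tr A) = free_for x t A.
Proof.
elim: A => [|u v|R ts|B IHB C IHC|B IHB C IHC|B IHB C IHC|y B IHB|y B IHB] //=;
  rewrite ?IHB ?IHC //.
- by have /= -> := fv_tr (All y B).
- by have /= -> := fv_tr (Ex y B).
Qed.

Definition ubase (B : uform L) : Prop := Jplus B \/ fol_eq B.

Lemma ubase_sentence (B : uform L) : ubase B -> sentence B.
Proof.
case=> [[C|i j x _|R i x k _ _|s x _ _]|[x|x y _|x y z _|R x y _|f x y _]];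
  try exact: univ_closure_sentence.
by case=> *; apply: univ_closure_sentence.
Qed.

(** The function axioms of [J] carry sort information from variables up to terms. They speak of
    distinct variables, so an instance on variables foreign to the term is chosen and the arguments
    are substituted into it. *)
Lemma uder_Q (T : uform L -> Prop) t i :
  (forall B : uform L, ubase B -> T B) -> {in tfv t, forall x, T (Qv x)} ->
  has_sort t i -> uder T (Q i t).
Proof.
move=> hT + ht; elim: ht => {t i} [x|f ts i j _ IH hf] hfv.
  by apply: der_ass => //; apply: hfv; rewrite inE.
have [x [ux xi xt]] := fresh_ffun i (tfv (App f ts)).
have [s [sx _]] := ffun_of_inj ts Var ux.
set A : uform L := ImpAll [seq Q (i k) (Var (x k)) | k <- enum 'I_(arity f)]
                 (Q j (App f [ffun k => Var (x k)])).
have fvA z : z \in fv A -> exists k, z = x k.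
  case/mem_fv_ImpAll => [[C /In_map [k _ ->]]|].
    by rewrite fv_Q inE => /eqP ->; exists k.
  rewrite fv_Q => /mem_tfvs [k]; rewrite ffunE inE => /eqP ->; by exists k.
have : uder T (ssubst s A).
  apply: der_closure_inst.
  - by apply: bv_ImpAll => // C /In_map [k _ ->].
  - by [].
  - move=> _ z /fvA [k ->] /fvA [l ->]; rewrite sx.
    by apply: contra (xt l) => h; apply/mem_tfvs; exists k.
  - by apply: der_ass => //; apply: hT; left; exact: Jplus_J (J_fun hf ux).
rewrite ssubst_ImpAll Q_ssubst /=.
have -> : [ffun k => tssubst s ([ffun k => Var (x k)] k)] = ts.
  by apply/ffunP => k; rewrite !ffunE /= sx.
move/der_ImpAll; apply => C /In_map [C' /In_map [k _ ->] ->].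
rewrite Q_ssubst /= sx; apply: IH => z hz.
by apply: hfv; apply/mem_tfvs; exists k.
Qed.

Definition uctx (G : seq (sform L)) (B : uform L) : Prop :=
  (exists2 A, List.In A G & B = tr A) \/ (exists x, B = Qv x) \/ ubase B.

Lemma uctx_cons A G (B : uform L) : uctx (A :: G) B -> add (tr A) (uctx G) B.
Proof.
case=> [[C [<- ->|hC ->]]|h]; [by left|by right; left; exists C|by right; right].
Qed.

(** The context [uctx G] mentions every variable and so admits no eigenvariable. Without [Qv y] it
    is free of [y] as soon as [G] is. *)
Definition uctx_but (y : var L) (G : seq (sform L)) (B : uform L) : Prop :=
  (exists2 A, List.In A G & B = tr A) \/
  (exists2 x, x != y & B = Qv x) \/ ubase B.

Lemma uctx_butW y G (B : uform L) : uctx_but y G B -> uctx G B.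
Proof.
case=> [h|[[x _ ->]|h]]; [by left|by right; left; exists x|by right; right].
Qed.

Lemma uctx_but_add y G (B : uform L) : uctx G B -> add (Qv y) (uctx_but y G) B.
Proof.
case=> [h|[[x ->]|h]]; [by right; left| |by right; right; right].
case: (eqVneq x y) => [->|ne]; first by left.
by right; right; left; exists x.
Qed.

Lemma uctx_but_fresh y G :
  (forall A, List.In A G -> y \notin fv A) ->
  forall B : uform L, uctx_but y G B -> y \notin fv B.
Proof.
move=> hG B [[A hA ->]|[[x ne ->]|/ubase_sentence -> //]].
  by rewrite fv_tr; apply: hG.
by rewrite fv_Q inE eq_sym.
Qed.

Lemma nd_tr G A :
  nd (@well_sorted L) (fun x t => has_sort t (vsort x)) G A ->
  uder (uctx G) (tr A).
Proof.
(* The guard [Qv x] has no free variable besides [x], so relativizing preserves the eigenvariable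
   condition. *)
have eig x y B : y = x \/ y \notin fv B ->
    y = x \/ y \notin fv (Qv x) ++ fv (tr B).
  rewrite mem_cat fv_Q fv_tr inE.
  by case: (eqVneq y x) => [->|_ [|]]; [left|left|right].
elim=> {G A}.
- by move=> G A _ hA; apply: der_ass => //; left; exists A.
- move=> G G' A hG _; apply: der_mono => B [[C /hG hC ->]|h]; last by right.
  by left; exists C.
- move=> G A _ _ IH; apply: der_raa => //.
  by apply: der_mono IH => B /uctx_cons.
- by move=> G A B _ IA _ IB; apply: der_andI.
- by move=> G A B _; apply: der_andE1.
- by move=> G A B _; apply: der_andE2.
- by move=> G A B _ _; apply: der_orI1.
- by move=> G A B _ _; apply: der_orI2.
- move=> G A B C _ IO _ IA _ IB; apply: (der_orE _ _ IO) => //.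
  + by apply: der_mono IA => E /uctx_cons.
  + by apply: der_mono IB => E /uctx_cons.
- move=> G A B _ _ IH; apply: der_impI => //.
  by apply: der_mono IH => E /uctx_cons.
- by move=> G A B _ IAB _ IA; apply: der_impE IA.
- move=> G x y A _ /has_sort_var_inv exy [ff hy hG] _ IH.
  apply: (@der_mono _ _ _ _ _ (uctx_but y G)); first exact: uctx_butW.
  apply: (@der_allI _ _ _ _ _ _ x y (Imp (Qv x) (tr A))) => //.
  + by rewrite /= free_for_tr.
  + exact: eig.
  + exact: uctx_but_fresh.
  + change (uder (uctx_but y G)
      (Imp (subst x (Var y) (Qv x)) (subst x (Var y) (tr A)))).
    (* As [y] has the sort of [x], the instantiated guard is [Qv y], precisely the assumption
       removed from the context. *)
    rewrite Qv_subst -exy -tr_subst; apply: der_impI => //.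
    by apply: der_mono IH => B /(uctx_but_add y).
- move=> G x t A ht ff _ IH; apply: (@der_impE _ _ _ _ _ _ (Q (vsort x) t)).
    rewrite tr_subst -Qv_subst.
    apply: (@der_allE _ _ _ _ _ _ x t (Imp (Qv x) (tr A))) => //.
    by rewrite /= free_for_tr.
  apply: uder_Q => // [B hB|z _]; first by right; right.
  by right; left; exists z.
- move=> G x t A _ ht ff _ IH; apply: (@der_exI _ _ _ _ _ _ x t (And (Qv x) (tr A))) => //.
    by rewrite /= free_for_tr.
  change (uder (uctx G) (And (subst x t (Qv x)) (subst x t (tr A)))).
  rewrite Qv_subst -tr_subst.
  apply: der_andI => //; apply: uder_Q => // [B hB|z _]; first by right; right.
  by right; left; exists z.
- move=> G x y A C /has_sort_var_inv exy [ff hy hG] _ IE _ IC.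
  (* The derivation of the existential may itself use [Qv y]. It is detached here, so that only the
     remaining implication has to be derived without [Qv y]. *)
  apply: der_impE IE.
  apply: (@der_mono _ _ _ _ _ (uctx_but y G)); first exact: uctx_butW.
  apply: der_impI => //.
  have hE : y \notin fv (tr (Ex x A)).
    rewrite fv_tr /= mem_filter; case: hy => [->|/negbTE ->]; last by rewrite andbF.
    by rewrite eqxx.
  apply: (@der_exE _ _ _ _ _ _ x y (And (Qv x) (tr A))) => //.
  + by rewrite /= free_for_tr.
  + exact: eig.
  + move=> B [-> //|]; apply: uctx_but_fresh => E hE'.
    by apply: hG; right.
  + by rewrite fv_tr; apply: hG; left.
  + by apply: der_ass => //; left.
  + set AQ := subst _ _ _.
    have {AQ}->: AQ = And (Qv y) (tr (subst x (Var y) A)).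
      by rewrite tr_subst /Qv exy -Qv_subst.
    apply: (@der_cut _ _ _ _ _ _ (Qv y)) => //.
      by apply: (@der_andE1 _ _ _ _ _ _ _ (tr (subst x (Var y) A)));
        apply: der_ass => //; left.
    apply: (@der_cut _ _ _ _ _ _ (tr (subst x (Var y) A))) => //.
      by apply: (@der_andE2 _ _ _ _ _ _ (Qv y)); apply: der_ass => //; right; left.
    apply: der_mono IC => B /uctx_cons [->|/(uctx_but_add y) [->|hB]].
    * by left.
    * by right; left.
    * by right; right; right; right.
Qed.

(** A derivation uses [Qv x] for finitely many [x] only. Each is removed by eliminating the axiom
    that its sort is inhabited, with [x] itself as eigenvariable: [T] and [A] are closed, and the
    remaining assumptions concern other variables. *)
Lemma uder_drop_Q (T : uform L -> Prop) (A : uform L) :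
  (forall B : uform L, T B -> sentence B) ->
  (forall B : uform L, ubase B -> T B) -> sentence A ->
  uder (fun B : uform L => T B \/ exists x, B = Qv x) A -> uder T A.
Proof.
move=> sT hT sA [G hG d].
have [X] : exists X : seq (var L),
    uder (fun B : uform L => T B \/ exists2 x, x \in X & B = Qv x) A.
  suff [X hX] : exists X : seq (var L), forall B : uform L, List.In B G ->
      T B \/ exists2 x, x \in X & B = Qv x.
    by exists X; exists G.
  elim: {d} G hG => [|B G IH] hG; first by exists [::] => B [].
  have [|X hX] := IH; first by move=> C hC; apply: hG; right.
  have [hB|[x ->]] := hG B (or_introl erefl).
    by exists X => C [<-|/hX //]; left.
  exists (x :: X) => C [<-|/hX [|[z hz ->]]].
  - by right; exists x; rewrite ?inE ?eqxx.
  - by left.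
  - by right; exists z; rewrite ?inE ?hz ?orbT.
elim: X {G hG d} => [|x X IH] d; first by apply: der_mono d => B [|[]].
(* A repeated [x] is merely dropped; it must not remain in [X] when it serves as eigenvariable. *)
apply: IH; have [xX|xX] := boolP (x \in X).
  apply: der_mono d => B [|[z]]; first by left.
  rewrite inE => hz ->; right; exists z => //.
  by case/orP: hz => // /eqP ->.
have cE : sentence (Ex x (Qv x)).
  by rewrite /sentence [fv _]/([seq y <- fv (Qv x) | y != x]) fv_Q /= eqxx.
apply: (@der_exE _ _ _ _ _ _ x x (Qv x)) => //.
- by left.
- move=> B [/sT -> //|[z hz ->]].
  by rewrite fv_Q inE; apply: contra xX => /eqP ->.
- by rewrite sA.
- apply: der_ass => //; left; apply: hT; left; apply: Jplus_J.
  by rewrite -(univ_closure_id cE); apply: J_inh.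
- rewrite subst_var; apply: der_mono d => B [hB|[z]]; first by right; left.
  rewrite inE => /orP [/eqP -> ->|hz ->]; first by left.
  by right; right; exists z.
Qed.

Lemma tr_ImpAll (l : seq (sform L)) B :
  tr (ImpAll l B) = ImpAll [seq tr A | A <- l] (tr B).
Proof.
case: l => // A l; rewrite /ImpAll /=; congr Imp.
elim: l A => // A' l IH A.
by change (And (tr A) (tr (bigAnd (A' :: l))) =
           And (tr A) (bigAnd [seq tr B | B <- A' :: l])); congr And; apply: IH.
Qed.

(** The left-hand closure is unrelativized, hence stronger: each quantifier is instantiated by its
    own variable and reintroduced with a guard. *)
Lemma uder_tr_closure (T : uform L -> Prop) A :
  uder T (univ_closure (tr A)) -> uder T (tr (univ_closure A)).
Proof.
rewrite /univ_closure fv_tr => d; apply: der_cut d _ => //.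
apply: (@der_mono _ _ _ _ _ (eq (foldr (@All _ _ (urels L)) (tr A) (undup (fv A))))).
  by move=> B <-; left.
elim: (undup _) => [|x xs IH]; first exact: der_ass.
set B := foldr _ _ xs in IH; set C := foldr _ _ xs in IH.
have d : uder (eq (All x B)) B.
  rewrite -{2}[B](subst_var x); apply: der_allE => //; last exact: der_ass.
  exact: free_for_var.
apply: (@der_allI _ _ _ _ _ _ x x (Imp (Qv x) (tr C))) => //.
- exact: free_for_var.
- by left.
- by move=> E <-; rewrite /= mem_filter eqxx.
- rewrite subst_var; apply: der_impI => //; apply: der_add.
  by apply: der_trans IH => E <-.
Qed.

Lemma msl_eq_tr A : msl_eq A -> uder (@fol_eq _ _ _) (tr A).
Proof.
case=> [x|x y h _|x y z h _ _|R i x y _ h _ _|f i j x y _ h _ _];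
  apply: uder_tr_closure; apply: der_ass => //.
- exact: fol_eq_refl.
- exact: fol_eq_sym.
- exact: fol_eq_trans.
- rewrite /eq_rel_ax tr_ImpAll -map_comp.
  exact: (@fol_eq_rel _ _ (urels L) (inl R) x y).
- by rewrite /eq_fun_ax tr_ImpAll -map_comp; apply: fol_eq_fun.
Qed.

Lemma msl_eq_sentence A : msl_eq A -> sentence A.
Proof. by case=> *; apply: univ_closure_sentence. Qed.

Lemma msl_eq_sorted A : msl_eq A -> well_sorted A.
Proof.
have sv i x : vsort x = i -> has_sort (Var x : sterm L) i.
  by move=> <-; apply: has_sort_var.
case=> [x|x y _ e|x y z _ e e'|R i x y ri _ xi yi|f i j x y fi _ xi yi];
  apply: well_sorted_univ_closure.
- by exists (vsort x); split; apply: sv.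
- by split; exists (vsort x); split; apply: sv.
- by split; [split|]; exists (vsort x); split; apply: sv; rewrite // -?e' -?e.
- apply: well_sorted_ImpAll => [C /In_map [k _ ->]|].
    by exists (i k); split; apply: sv.
  by split; exists i; split=> // k; rewrite ffunE; apply: sv.
- apply: well_sorted_ImpAll => [C /In_map [k _ ->]|].
    by exists (i k); split; apply: sv.
  by exists j; split; apply: has_sort_app fi => k; rewrite ffunE; apply: sv.
Qed.

Lemma msl_to_fol T A :
  (forall B, T B -> sentence B) -> sentence A -> msl_derives T A ->
  fol_derives (fun B : uform L => (exists2 C, T C & B = tr C) \/ Jplus B) (tr A).
Proof.
move=> sT sA [G hG /nd_tr d].
(* Keeping only the translations of members of [G] makes the intermediate theory closed, as removing
   the assumptions [Qv x] requires. *)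
apply: (@der_trans _ _ _ _ _ _
  (fun B : uform L => (exists2 C, List.In C G & B = tr C) \/ ubase B)).
  move=> B hB; split=> //; case: hB => [[C /hG [hC|/msl_eq_tr hC] ->]|[hB|hB]].
  - by apply: der_ass => //; left; left; exists C.
  - by apply: der_mono hC => B'; right.
  - by apply: der_ass => //; left; right.
  - by apply: der_ass => //; right.
apply: uder_drop_Q => [B [[C /hG hC ->]|/ubase_sentence //]|B|//|].
- by rewrite /sentence fv_tr; case: hC => [/sT|/msl_eq_sentence].
- by right.
- by rewrite /sentence fv_tr.
- by apply: der_mono d => B [h|[h|h]]; [left; left|right|left; right].
Qed.

End Sorted.

(** * Henkin completion *)

Section Coding.

Variables (V : countType) (F P : alphabet).

(** Only injectivity matters: the completion runs through the formulas by the number of their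
    code. *)
Fixpoint tcode (t : term V F) : GenTree.tree nat :=
  match t with
  | Var x => GenTree.Leaf (pickle x)
  | App f ts =>
      GenTree.Node (pickle f) [seq tcode (ts k) | k <- enum 'I_(arity f)]
  end.

Fixpoint code (A : form V F P) : GenTree.tree nat :=
  match A with
  | Bot => GenTree.Node 0 [::]
  | Eq t u => GenTree.Node 1 [:: tcode t; tcode u]
  | Rel R ts => GenTree.Node 2
      (GenTree.Leaf (pickle R) :: [seq tcode (ts k) | k <- enum 'I_(arity R)])
  | And B C => GenTree.Node 3 [:: code B; code C]
  | Or B C => GenTree.Node 4 [:: code B; code C]
  | Imp B C => GenTree.Node 5 [:: code B; code C]
  | All x B => GenTree.Node 6 [:: GenTree.Leaf (pickle x); code B]
  | Ex x B => GenTree.Node 7 [:: GenTree.Leaf (pickle x); code B]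
  end.

Lemma tcode_inj : injective tcode.
Proof.
elim/term_ffun_ind => [x|f ts IH] [y|g us] //=.
  by case=> /(pcan_inj pickleK) ->.
case=> /(pcan_inj pickleK) e; subst g => /eq_in_map h.
by congr App; apply/ffunP => k; apply/IH/h; rewrite mem_enum.
Qed.

Lemma code_inj : injective code.
Proof.
elim=> [|t u|R ts|B IHB C IHC|B IHB C IHC|B IHB C IHC|x B IHB|x B IHB]
  [|t' u'|R' ts'|B' C'|B' C'|B' C'|x' B'|x' B'] //=.
- by case=> /tcode_inj -> /tcode_inj ->.
- case=> /(pcan_inj pickleK) e; subst R' => /eq_in_map h.
  by congr Rel; apply/ffunP => k; apply/tcode_inj/h; rewrite mem_enum.
- by case=> /IHB -> /IHC ->.
- by case=> /IHB -> /IHC ->.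
- by case=> /IHB -> /IHC ->.
- by case=> /(pcan_inj pickleK) -> /IHB ->.
- by case=> /(pcan_inj pickleK) -> /IHB ->.
Qed.

End Coding.

Section Completion.

Variable L : msl_sig.

Local Notation mder :=
  (@der _ _ (rels L) (@well_sorted L) (fun x t => has_sort t (vsort x))).

Implicit Types (A B C : sform L) (t u : sterm L).

Variables (T : sform L -> Prop) (S : seq (var L)).
Hypothesis T_sentence : forall A, T A -> sentence A.
Hypothesis T_sorted : forall A, T A -> well_sorted A.

Let ctx (l : seq (sform L)) B := T B \/ List.In B l.

(** A stage is a finite extension of the closed theory [T], so some variable of any given sort is
    fresh for it. *)
Definition state (l : seq (sform L)) : Prop :=
  (forall B, List.In B l -> well_sorted B) /\ ~ mder (ctx l) Bot.

Lemma ctx_cons A l B : ctx (A :: l) B -> add A (ctx l) B.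
Proof. by case=> [h|[->|h]]; [right; left|left|right; right]. Qed.

Lemma state_cons A l : well_sorted A -> state l ->
  ~ mder (add A (ctx l)) Bot -> state (A :: l).
Proof.
move=> wA [wl cl] h; split=> [B [<- //|/wl //]|d].
by apply: h; apply: der_mono d => B /ctx_cons.
Qed.

(** Stage [n] concerns at most one formula, the one numbered [n]: it is decided, and if it is an
    accepted existential it receives a witness at once. *)
Lemma henkin_step n l : state l ->
  exists l', [/\ state l', forall B, List.In B l -> List.In B l'
    & forall A, well_sorted A -> pickle (code A) = n ->
        (List.In A l' \/ List.In (Neg A) l') /\
        forall x B, A = Ex x B -> List.In A l' ->
          exists y, [/\ y \notin S, vsort y = vsort x
                      & List.In (subst x (Var y) B) l']].
Proof.
move=> sl.
have [[A [wA cA]]|none] :=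
  classic (exists A, well_sorted A /\ pickle (code A) = n); last first.
  by exists l; split=> // A wA cA; case: none; exists A.
have uA A' : pickle (code A') = n -> A' = A.
  by rewrite -cA => /(pcan_inj pickleK) /code_inj.
have [l1 [sl1 sub dec]] : exists l1, [/\ state l1,
    forall B, List.In B l -> List.In B l1 &
    List.In A l1 \/ List.In (Neg A) l1].
  (* If both [A] and its negation were refutable, [l] would be inconsistent already. *)
  have [h|h] := classic (mder (add A (ctx l)) Bot); last first.
    exists (A :: l); split; [exact: state_cons|by right|by left; left].
  exists (Neg A :: l); split; [|by right|by right; left].
  apply: state_cons => // h'; case: sl => _; apply.
  by apply: der_cut h'; [|apply: der_impI].
have [[x [B [eA hA]]]|none] :=
  classic (exists x B, A = Ex x B /\ List.In A l1); last first.
  exists l1; split=> // A' _ /uA ->; split=> // x B e h.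
  by case: none; exists x, B.
(* Avoiding [bv B] prevents capture, avoiding [fv B] and the list gives the eigenvariable condition,
   and avoiding [S] makes [y] an element of the later model. *)
have [y ey] := var_inf (vsort x)
  (S ++ bv B ++ fv B ++ flatten [seq fv C | C <- l1]).
rewrite !mem_cat !negb_or => /and4P [yS yb yf yl].
have wB : well_sorted (subst x (Var y) B).
  apply: well_sorted_subst; last by rewrite eA in wA.
  by rewrite -ey; apply: has_sort_var.
exists (subst x (Var y) B :: l1); split.
- apply: state_cons => // d; case: (sl1) => _; apply.
  apply: (@der_exE _ _ _ _ _ _ x y B) d => //.
  + by rewrite -ey; apply: has_sort_var.
  + by apply: free_for_bv => z hz; rewrite inE; apply: contra yb => /eqP <-.
  + by right.
  + move=> C [/T_sentence -> //|hC]; apply: contra yl => hy.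
    elim: (l1) hC => //= C' l' IH [->|/IH h]; rewrite mem_cat ?hy //.
    by rewrite h orbT.
  + by apply: der_ass; [|right]; rewrite -eA.
- by move=> C /sub; right.
- move=> A' _ /uA ->; split; first by case: dec; [left|right]; right.
  move=> x' B'; rewrite eA => -[<- <-] _; exists y; split=> //.
  by left.
Qed.

Lemma henkin_completion l : state l ->
  exists D : sform L -> Prop,
    [/\ forall A, T A -> D A, forall A, List.In A l -> D A,
        forall A, D A -> well_sorted A, ~ mder D Bot
      & (forall A, well_sorted A -> D A \/ D (Neg A)) /\
        forall x B, D (Ex x B) ->
          exists y, [/\ y \notin S, vsort y = vsort x
                      & D (subst x (Var y) B)]].
Proof.
move=> sl.
(* The existence statement of each step becomes a function by choice, so that stages can be defined
   by recursion together with their consistency. *)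
pose next n (l : {l | state l}) :=
  constructive_indefinite_description _ (henkin_step n (proj2_sig l)).
pose st := fix st n : {l | state l} := if n is m.+1 then
  let: exist l' h := next m (st m) in exist _ l' (let: And3 s _ _ := h in s)
  else exist _ l sl.
pose ls n := sval (st n).
have sls n : state (ls n) by rewrite /ls; case: (st n).
have lsS n : (forall B, List.In B (ls n) -> List.In B (ls n.+1)) /\
    forall A, well_sorted A -> pickle (code A) = n ->
        (List.In A (ls n.+1) \/ List.In (Neg A) (ls n.+1)) /\
        forall x B, A = Ex x B -> List.In A (ls n.+1) ->
          exists y, [/\ y \notin S, vsort y = vsort x
                      & List.In (subst x (Var y) B) (ls n.+1)].
  by rewrite /ls /=; case: (next n (st n)) => l' [].
have mono n m B : n <= m -> List.In B (ls n) -> List.In B (ls m).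
  move/subnKC <-; elim: (m - n) => [|k IH]; first by rewrite addn0.
  by rewrite addnS => /IH; case: (lsS (n + k)) => h _ /h.
pose D A := T A \/ exists n, List.In A (ls n).
have cD : ~ mder D Bot.
  case=> G hG d.
  (* The stages increase, so the finitely many assumptions of a refutation all lie in a single
     one. *)
  have [n hn] : exists n, forall B, List.In B G -> ctx (ls n) B.
    elim: {d} G hG => [|B G IH] hG; first by exists 0.
    have [|n hn] := IH; first by move=> C hC; apply: hG; right.
    have [hB|[m hm]] := hG B (or_introl erefl).
      by exists n => C [<-|/hn //]; left.
    exists (maxn n m) => C [<-|/hn [|hC]].
    - by right; apply: mono hm; apply: leq_maxr.
    - by left.
    - by right; apply: mono hC; apply: leq_maxl.
  by case: (sls n) => _; apply; exists G.
exists D; split=> //.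
- by move=> A; left.
- by move=> A hA; right; exists 0.
- by move=> A [/T_sorted //|[n hn]]; case: (sls n) => w _; apply: w.
split=> [A wA|x B hE].
  have [_ /(_ A wA erefl) [[h|h] _]] := lsS (pickle (code A)).
  - by left; right; exists (pickle (code A)).+1.
  - by right; right; exists (pickle (code A)).+1.
have wE : well_sorted (Ex x B).
  by case: hE => [/T_sorted //|[n hn]]; case: (sls n) => w _; apply: w.
have [_ /(_ _ wE erefl) [dec wit]] := lsS (pickle (code (Ex x B))).
(* The existential may have entered [D] through [T] or at a stage other than its own. Its own stage
   decides it, and by consistency in its favour, so the witness is added there. *)
have [|y [yS ey hy]] := wit x B erefl.
  case: dec => // h; case: cD; apply: (@der_impE _ _ _ _ _ _ (Ex x B)).
    by apply: der_ass => //; right; exists (pickle (code (Ex x B))).+1.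
  exact: der_ass.
by exists y; split=> //; right; exists (pickle (code (Ex x B))).+1.
Qed.

End Completion.

(** * The term model *)

Section TermModel.

Variable L : msl_sig.

Local Notation mder :=
  (@der _ _ (rels L) (@well_sorted L) (fun x t => has_sort t (vsort x))).

Implicit Types (A B C : sform L) (t u v : sterm L).

Variables (D : sform L -> Prop) (S : seq (var L)).
Hypothesis D_eq : forall A, msl_eq A -> D A.
Hypothesis D_sorted : forall A, D A -> well_sorted A.
Hypothesis D_consistent : ~ mder D Bot.
Hypothesis D_complete : forall A, well_sorted A -> D A \/ D (Neg A).
Hypothesis D_henkin : forall x B, D (Ex x B) ->
  exists y, [/\ y \notin S, vsort y = vsort x & D (subst x (Var y) B)].

(** * Connectives and quantifiers in a complete Henkin set *)

Lemma D_ass A : D A -> mder D A.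
Proof. by move=> hA; apply: der_ass => //; apply: D_sorted. Qed.

Lemma D_closed A : well_sorted A -> mder D A -> D A.
Proof.
move=> wA d; case: (D_complete wA) => // h; case: D_consistent.
exact: der_impE (D_ass h) d.
Qed.

Lemma D_Neg A : well_sorted A -> D (Neg A) <-> ~ D A.
Proof.
move=> wA; split=> [h hA|h]; last by case: (D_complete wA).
by apply: D_consistent; apply: der_impE (D_ass h) (D_ass hA).
Qed.

Lemma D_And A B : D (And A B) <-> D A /\ D B.
Proof.
split=> [h|[hA hB]].
  have [wA wB] := D_sorted h.
  split; apply: D_closed => //.
  - exact: der_andE1 (D_ass h).
  - exact: der_andE2 (D_ass h).
apply: D_closed; first by split; apply: D_sorted.
by apply: der_andI; apply: D_ass.
Qed.

Lemma D_Or A B : well_sorted A -> well_sorted B -> D (Or A B) <-> D A \/ D B.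
Proof.
move=> wA wB; split=> [h|h]; last first.
  apply: D_closed => //; case: h => h.
  - by apply: der_orI1 => //; apply: D_ass.
  - by apply: der_orI2 => //; apply: D_ass.
have [|/(D_Neg wA) nA] := classic (D A); first by left.
right; apply: D_closed => //; apply: der_orE (D_ass h) _ _ => //.
- apply: der_bot => //; apply: (@der_impE _ _ _ _ _ _ A).
    by apply: der_add; apply: D_ass.
  by apply: der_ass => //; left.
- by apply: der_ass => //; left.
Qed.

Lemma D_Imp A B : well_sorted A -> well_sorted B ->
  D (Imp A B) <-> (D A -> D B).
Proof.
move=> wA wB; split=> [h hA|h].
  by apply: D_closed => //; apply: der_impE (D_ass h) (D_ass hA).
apply: D_closed => //; apply: der_impI => //.
have [hA|/(D_Neg wA) nA] := classic (D A).
  by apply: der_add; apply: D_ass; apply: h.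
apply: der_bot => //; apply: (@der_impE _ _ _ _ _ _ A).
  by apply: der_add; apply: D_ass.
by apply: der_ass => //; left.
Qed.

(** The bound variables of [B] lie in [S] and the instances avoid [S], so no variable is captured.
    Henkin witnesses are variables, but the converse direction admits all terms of the model. *)
Lemma D_Ex x B : {subset bv B <= S} -> well_sorted B ->
  D (Ex x B) <->
  exists t, [/\ has_sort t (vsort x), {in tfv t, forall z, z \notin S}
              & D (subst x t B)].
Proof.
move=> hB wB; split=> [/D_henkin [y [yS ey hy]]|[t [ht tS h]]].
  exists (Var y); split=> //; first by rewrite -ey; apply: has_sort_var.
  by move=> z; rewrite inE => /eqP ->.
apply: D_closed => //; apply: der_exI (D_ass h) => //.
by apply: free_for_bv => z /hB zS; apply: contraL zS => /tS.
Qed.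

Lemma D_All x B : {subset bv B <= S} -> well_sorted B ->
  D (All x B) <->
  forall t, has_sort t (vsort x) -> {in tfv t, forall z, z \notin S} ->
    D (subst x t B).
Proof.
move=> hB wB; split=> [h t ht tS|h].
  apply: D_closed; first exact: well_sorted_subst.
  apply: der_allE (D_ass h) => //.
  by apply: free_for_bv => z /hB zS; apply: contraL zS => /tS.
have [//|nE] := @D_complete (All x B) wB.
(* Witnesses exist for existentials only, so a failing universal is first turned into an existential
   counterexample. In the theory [X] the variable [x] is free nowhere and is its own
   eigenvariable. *)
have : D (Ex x (Neg B)).
  apply: D_closed => //.
  pose X := add (Neg (Ex x (Neg B))) (eq (Neg (All x B))).
  suff: mder X Bot.
    move=> d; apply: der_raa => //; apply: der_mono d => C [->|<-].
      by left.
    by right.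
  apply: (@der_impE _ _ _ _ _ _ (All x B)); first by apply: der_ass => //; right.
  apply: (@der_allI _ _ _ _ _ _ x x) => //.
  - exact: has_sort_var.
  - exact: free_for_var.
  - by left.
  - by move=> C [->|<-]; rewrite /= cats0 mem_filter eqxx.
  rewrite subst_var; apply: der_raa => //.
  apply: (@der_impE _ _ _ _ _ _ (Ex x (Neg B))).
    by apply: der_ass => //; right; left.
  apply: (@der_exI _ _ _ _ _ _ x (Var x)) => //.
  - exact: has_sort_var.
  - exact: free_for_var.
  - by rewrite subst_var; apply: der_ass => //; left.
case/D_henkin => y [yS ey] /=.
have hy : has_sort (Var y : sterm L) (vsort x) by rewrite -ey; apply: has_sort_var.
move/(D_Neg (well_sorted_subst hy wB)); case; apply: h => //.
by move=> z; rewrite inE => /eqP ->.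
Qed.

(** Equality axioms are closed and stated for distinct variables. Choosing these foreign to [t] and
    [u] turns the successive instantiations of an axiom into one simultaneous substitution; two
    tuples serve the two sides of a congruence. *)
Lemma D_inst n (i : {ffun 'I_n -> sort L}) (t u : {ffun 'I_n -> sterm L}) :
  (forall k, has_sort (t k) (i k)) -> (forall k, has_sort (u k) (i k)) ->
  exists x y : {ffun 'I_n -> var L}, exists s,
    [/\ uniq (codom x ++ codom y),
        (forall k, vsort (x k) = i k) /\ (forall k, vsort (y k) = i k),
        (forall k, s (x k) = t k) /\ (forall k, s (y k) = u k)
      & forall A, well_sorted A -> bv A = [::] ->
          {subset fv A <= codom x ++ codom y} -> D (univ_closure A) ->
          D (ssubst s A)].
Proof.
move=> ht hu.
pose fvs := flatten [seq tfv (t k) | k <- enum 'I_n] ++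
            flatten [seq tfv (u k) | k <- enum 'I_n].
have [x [y [uxy xi yi xs ys]]] := fresh_ffun2 i fvs.
have [ux [nxy uy]] : uniq (codom x) /\ ~~ has [in codom x] (codom y) /\
    uniq (codom y) by move: uxy; rewrite cat_uniq => /and3P [].
have [s1 [s1y _]] := ffun_of_inj u Var uy.
have [s [sx s_s1]] := ffun_of_inj t s1 ux.
have sy k : s (y k) = u k.
  by rewrite s_s1 ?s1y // inE; apply: (hasPn nxy); apply: codom_f.
exists x, y, s; split=> // A wA qA fA hA.
have sfv z : z \in fv A -> has_sort (s z) (vsort z) /\
    {subset tfv (s z) <= fvs} /\ z \notin fvs.
  move/fA; rewrite mem_cat => /orP [] /codomP [k ->].
    rewrite sx xi; split=> //; split=> // w hw.
    by rewrite mem_cat; apply/orP; left; apply/mem_tfvs; exists k.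
  rewrite sy yi; split=> //; split=> // w hw.
  by rewrite mem_cat; apply/orP; right; apply/mem_tfvs; exists k.
apply: D_closed; first by apply: well_sorted_ssubst => // z /sfv [].
apply: der_closure_inst (D_ass hA) => // [z /sfv [] //|z w].
by move=> /sfv [_ [sub _]] /sfv [_ [_]]; apply: contra => /sub.
Qed.

(** * Equality in [D] is a congruence *)

Lemma D_refl t i : has_sort t i -> D (Eq t t).
Proof.
move=> ht.
have [||x [y [s [_ [xi yi] [sx _] inst]]]] :=
  @D_inst 1 [ffun=> i] [ffun=> t] [ffun=> t]; try by move=> k; rewrite !ffunE.
have := inst (eq_refl_ax _ _ (x ord0)); rewrite /= sx ffunE; apply=> //.
- by exists (vsort (x ord0)); split; apply: has_sort_var.
- by move=> z; rewrite !inE orbb => /eqP ->; rewrite mem_cat codom_f.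
- by apply: D_eq; constructor.
Qed.

Lemma D_sym t u : D (Eq t u) -> D (Eq u t).
Proof.
move=> h; have [i [ht hu]] := D_sorted h.
have [||x [y [s [uxy [xi yi] [sx sy] inst]]]] :=
  @D_inst 1 [ffun=> i] [ffun=> t] [ffun=> u]; try by move=> k; rewrite !ffunE.
have uxy0 : uniq [:: x ord0; y ord0].
  by move: uxy; rewrite !codomE enum_ordSl enum_ord0.
have hx : has_sort (Var (x ord0) : sterm L) i.
  by have := has_sort_var (x ord0); rewrite xi ffunE.
have hy : has_sort (Var (y ord0) : sterm L) i.
  by have := has_sort_var (y ord0); rewrite yi ffunE.
have : D (Imp (Eq t u) (Eq u t)).
  have := inst (eq_sym_ax _ _ (x ord0) (y ord0)); rewrite /= sx sy !ffunE; apply=> //.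
  - by split; exists i.
  - move=> z; rewrite !inE mem_cat => /or4P [] /eqP ->;
      by rewrite codom_f ?orbT.
  - by apply: D_eq; constructor; rewrite // xi yi.
by move=> d; apply: D_closed; [exists i|apply: der_impE (D_ass d) (D_ass h)].
Qed.

Lemma D_trans t u v : D (Eq t u) -> D (Eq u v) -> D (Eq t v).
Proof.
move=> h h'; have [i [ht hu]] := D_sorted h; have [i' [hu' hv]] := D_sorted h'.
have e := has_sort_uniq hu' hu; subst i'.
(* Transitivity needs three variables: [x] has length two and carries [t] and [u], while [y ord0]
   carries [v]. *)
have [||x [y [s [uxy [xi yi] [sx sy] inst]]]] :=
  @D_inst 2 [ffun=> i] [ffun k => if k == ord0 then t else u] [ffun=> v].
- by move=> k; rewrite !ffunE; case: ifP.
- by move=> k; rewrite !ffunE.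
pose x0 := x ord0; pose x1 := x (lift ord0 ord0); pose y0 := y ord0.
have uxy0 : uniq [:: x0; x1; y0].
  move: uxy; rewrite !codomE !enum_ordSl enum_ord0 /= -/x0 -/x1 -/y0.
  by rewrite !inE !negb_or -!andbA => /and5P [-> -> _ -> _].
have hx k : has_sort (Var (x k) : sterm L) i.
  by have := has_sort_var (x k); rewrite xi ffunE.
have hy k : has_sort (Var (y k) : sterm L) i.
  by have := has_sort_var (y k); rewrite yi ffunE.
have : D (Imp (And (Eq t u) (Eq u v)) (Eq t v)).
  have := inst (eq_trans_ax _ _ x0 x1 y0).
  rewrite /= /x0 /x1 /y0 !sx !sy !ffunE /=; apply=> //.
  - by split; [split|]; exists i.
  - move=> z; rewrite !inE mem_cat.
    by do ![case/orP]; move/eqP ->; rewrite codom_f ?orbT.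
  - by apply: D_eq; constructor; rewrite // ?xi ?yi !ffunE.
move=> d; apply: D_closed; first by exists i.
by apply: der_impE (D_ass d) _; apply: der_andI; apply: D_ass.
Qed.

Lemma D_ImpAll (l : seq (sform L)) B :
  well_sorted B -> D (ImpAll l B) -> (forall A, List.In A l -> D A) -> D B.
Proof.
move=> wB h hl; apply: D_closed => //; apply: der_ImpAll (D_ass h) _ => A hA.
by apply: D_ass; apply: hl.
Qed.

Lemma fv_eqs n (x y : {ffun 'I_n -> var L}) B :
  {subset fv B <= codom x ++ codom y} ->
  {subset fv (ImpAll [seq Eq (Var (x k)) (Var (y k)) | k <- enum 'I_n] B)
     <= codom x ++ codom y}.
Proof.
move=> hB z /mem_fv_ImpAll [[C /In_map [k _ ->]]|/hB //].
by rewrite !inE mem_cat => /orP [] /eqP ->; rewrite codom_f ?orbT.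
Qed.

(** Sorting only the left side is enough: equations in [D] are well-sorted and sorts are unique, so
    [u] has the same sorts as [t]. *)
Lemma D_fun (f : funs L) (t u : {ffun 'I_(arity f) -> sterm L}) j :
  has_sort (App f t) j -> (forall k, D (Eq (t k) (u k))) ->
  D (Eq (App f t) (App f u)).
Proof.
move=> /has_sort_app_inv [i ht fi] tu.
have hu k : has_sort (u k) (i k).
  by have [a [hta hua]] := D_sorted (tu k); rewrite (has_sort_uniq (ht k) hta).
have [x [y [s [uxy [xi yi] [sx sy] inst]]]] := D_inst ht hu.
have hx k : has_sort (Var (x k) : sterm L) (i k).
  by rewrite -xi; apply: has_sort_var.
have hy k : has_sort (Var (y k) : sterm L) (i k).
  by rewrite -yi; apply: has_sort_var.
have := inst (eq_fun_ax _ f x y); rewrite /eq_fun_ax ssubst_ImpAll -map_comp /=.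
have -> : [ffun k => tssubst s ([ffun k => Var (x k)] k)] = t.
  by apply/ffunP => k; rewrite !ffunE /= sx.
have -> : [ffun k => tssubst s ([ffun k => Var (y k)] k)] = u.
  by apply/ffunP => k; rewrite !ffunE /= sy.
move=> d; apply: D_ImpAll (d _ _ _ _) _.
- by exists j; split; apply: has_sort_app fi.
- apply: well_sorted_ImpAll => [A /In_map [k _ ->]|]; first by exists (i k).
  by exists j; split; apply: has_sort_app fi => k; rewrite ffunE.
- by apply: bv_ImpAll => // A /In_map [k _ ->].
- apply: fv_eqs => z; rewrite [fv _]/(_ ++ _) !mem_cat.
  by case/orP => /mem_tfvs [k]; rewrite ffunE inE => /eqP ->;
    rewrite codom_f ?orbT.
- by apply: D_eq; apply: msl_eq_fun fi uxy xi yi.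
- by move=> A /In_map [k _ ->] /=; rewrite sx sy.
Qed.

Lemma D_rel (R : rels L) (t u : {ffun 'I_(arity R) -> sterm L}) :
  D (Rel R t) -> (forall k, D (Eq (t k) (u k))) -> D (Rel R u).
Proof.
move=> h tu; have [i [ht ri]] := D_sorted h.
have hu k : has_sort (u k) (i k).
  by have [a [hta hua]] := D_sorted (tu k); rewrite (has_sort_uniq (ht k) hta).
have [x [y [s [uxy [xi yi] [sx sy] inst]]]] := D_inst ht hu.
have hx k : has_sort (Var (x k) : sterm L) (i k).
  by rewrite -xi; apply: has_sort_var.
have hy k : has_sort (Var (y k) : sterm L) (i k).
  by rewrite -yi; apply: has_sort_var.
have := inst (eq_rel_ax _ R x y); rewrite /eq_rel_ax ssubst_ImpAll -map_comp /=.
have -> : [ffun k => tssubst s ([ffun k => Var (x k)] k)] = t.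
  by apply/ffunP => k; rewrite !ffunE /= sx.
have -> : [ffun k => tssubst s ([ffun k => Var (y k)] k)] = u.
  by apply/ffunP => k; rewrite !ffunE /= sy.
have wu : well_sorted (Rel R u) by exists i.
move=> d; suff d' : D (Imp (Rel R t) (Rel R u)).
  by apply: D_closed => //; apply: der_impE (D_ass d') (D_ass h).
have wt := D_sorted h.
apply: D_ImpAll (d _ _ _ _) _ => //.
- apply: well_sorted_ImpAll => [A /In_map [k _ ->]|]; first by exists (i k).
  by split; exists i; split=> // k; rewrite ffunE.
- by apply: bv_ImpAll => // A /In_map [k _ ->].
- apply: fv_eqs => z; rewrite [fv _]/(_ ++ _) !mem_cat.
  by case/orP => /mem_tfvs [k]; rewrite ffunE inE => /eqP ->;
    rewrite codom_f ?orbT.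
- by apply: D_eq; apply: msl_eq_rel ri uxy xi yi.
- by move=> A /In_map [k _ ->] /=; rewrite sx sy.
Qed.

(** All sorts share one domain. Requiring each element to have some sort is what validates the
    covering axiom when there are finitely many sorts. *)
Definition dom : Type :=
  {t : sterm L | (exists i, has_sort t i) /\ {in tfv t, forall z, z \notin S}}.

Definition in_dom t i (ht : has_sort t i)
    (tS : {in tfv t, forall z, z \notin S}) : dom :=
  exist _ t (conj (ex_intro _ i ht) tS).

Lemma dom_inh i : exists d : dom, has_sort (sval d) i.
Proof.
have [y ey yS] := var_inf i S.
have tS : {in tfv (Var y : sterm L), forall z, z \notin S}.
  by move=> z; rewrite inE => /eqP ->.
by exists (in_dom (has_sort_var y) tS); rewrite -ey; apply: has_sort_var.
Qed.

Variable d0 : dom.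

Definition vals n (ds : {ffun 'I_n -> dom}) : {ffun 'I_n -> sterm L} :=
  [ffun k => sval (ds k)].

Lemma vals_avoid (f : funs L) (ds : {ffun 'I_(arity f) -> dom}) :
  {in tfv (App f (vals ds)), forall z, z \notin S}.
Proof.
move=> z /mem_tfvs [k]; rewrite ffunE.
by case: (ds k) => t [_ ht] /=; apply: ht.
Qed.

(* Applications that are not well-sorted get the junk value [d0]. *)
Definition fun_int (f : funs L) (ds : {ffun 'I_(arity f) -> dom}) : dom :=
  match excluded_middle_informative (exists i, has_sort (App f (vals ds)) i) with
  | left h => exist _ (App f (vals ds)) (conj h (@vals_avoid f ds))
  | right _ => d0
  end.

Definition eq_int (d e : dom) : Prop := D (Eq (sval d) (sval e)).

(** [D] contains well-sorted formulas only, so a relation holds of no tuple outside its rank. The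
    symbol Q_i is read off the syntactic sort. *)
Definition rel_int (R : urels L) : {ffun 'I_(arity R) -> dom} -> Prop :=
  match R with
  | inl R => fun ds => D (Rel R (vals ds))
  | inr i => fun ds => has_sort (sval (ds ord0)) i
  end.

Local Notation msat := (@sat (var L) (funs L) (urels L) dom fun_int eq_int rel_int).
Local Notation meval := (@eval (var L) (funs L) dom fun_int).

Implicit Type r : var L -> dom.

Lemma fun_int_sorted (f : funs L) (ds : {ffun 'I_(arity f) -> dom}) i :
  has_sort (App f (vals ds)) i -> sval (fun_int ds) = App f (vals ds).
Proof.
move=> h; rewrite /fun_int; case: excluded_middle_informative => //.
by case; exists i.
Qed.

Lemma dom_sorted (d : dom) : exists i, has_sort (sval d) i.
Proof. by case: d => t []. Qed.

Lemma eq_int_refl d : eq_int d d.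
Proof. by have [i hi] := dom_sorted d; apply: D_refl hi. Qed.

(** If one application is well-sorted, its equation with the other is in [D], so both are; otherwise
    both values are [d0]. *)
Lemma fun_int_congr (f : funs L) (ds es : {ffun 'I_(arity f) -> dom}) :
  (forall k, eq_int (ds k) (es k)) -> eq_int (fun_int ds) (fun_int es).
Proof.
have half (a b : {ffun 'I_(arity f) -> dom}) i :
    (forall k, eq_int (a k) (b k)) -> has_sort (App f (vals a)) i ->
    eq_int (fun_int a) (fun_int b).
  move=> hab ha.
  have h : D (Eq (App f (vals a)) (App f (vals b))).
    by apply: D_fun ha _ => k; rewrite !ffunE; apply: hab.
  have [j [_ hb]] := D_sorted h.
  by rewrite /eq_int (fun_int_sorted ha) (fun_int_sorted hb).
move=> h.
have [[i hd]|nd] := classic (exists i, has_sort (App f (vals ds)) i).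
  exact: half hd.
have [[i he]|ne] := classic (exists i, has_sort (App f (vals es)) i).
  by apply: D_sym; apply: half he => k; apply: D_sym; apply: h.
rewrite /fun_int; case: excluded_middle_informative => // _.
by case: excluded_middle_informative => // _; apply: eq_int_refl.
Qed.

Lemma sat_fol_eq r (B : uform L) : fol_eq B -> msat r B.
Proof.
have eqs n (x y : {ffun 'I_n -> var L}) r' :
    (forall A : uform L,
      List.In A [seq Eq (Var (x k)) (Var (y k)) | k <- enum 'I_n] ->
      msat r' A) -> forall k, eq_int (r' (x k)) (r' (y k)).
  move=> h k; apply: (h (Eq (Var (x k)) (Var (y k)))).
  by apply/In_map; exists k => //; apply/In_mem; rewrite mem_enum.
case=> [x|x y _|x y z _|R x y _|f x y _]; apply: sat_univ_closure => {}r.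
- exact: eq_int_refl.
- exact: D_sym.
- by case=> h; apply: D_trans.
- apply: sat_ImpAll => /eqs; case: R x y => [R|i] x y h /=.
    move=> hx; apply: D_rel hx _ => k; rewrite !ffunE /=; exact: h.
  (* Congruence for Q_i: an equation in [D] forces both sides to have the same sort. *)
  rewrite !ffunE /= => hx.
  by have [j [hj hj']] := D_sorted (h ord0); rewrite (has_sort_uniq hx hj).
- apply: sat_ImpAll => /eqs h; apply: fun_int_congr => k.
  by rewrite !ffunE /=; apply: h.
Qed.

Lemma sat_Q r (i : sort L) t : msat r (Q i t) <-> has_sort (sval (meval r t)) i.
Proof. by rewrite /= !ffunE. Qed.

(** Inhabitation comes from a variable outside [S], disjointness from uniqueness of sorts, and
    covering from every element having a sort. For strict relations, an atom in [D] is well-sorted,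
    and only one tuple of sorts is available. *)
Lemma sat_Jplus r (B : uform L) : Jplus B -> msat r B.
Proof.
case=> [{}B [i x|f i j x fi _]|i j x ij|R i x k sR _|s x _ cov];
  apply: sat_univ_closure => {}r.
- have [d hd] := dom_inh i; exists d; apply/sat_Q.
  by rewrite /= /upd eqxx.
- apply: sat_ImpAll => h; apply/sat_Q => /=.
  have hj : has_sort (App f (vals [ffun k => meval r ([ffun k => Var (x k)] k)])) j.
    apply: has_sort_app fi => k; rewrite !ffunE /=.
    apply/(sat_Q r (i k) (Var (x k))); apply: h.
    by apply/In_map; exists k => //; apply/In_mem; rewrite mem_enum.
  by rewrite (fun_int_sorted hj).
- move=> /sat_Q hi /sat_Q hj.
  by case/eqP: ij; apply: has_sort_uniq hi hj.
- move=> hR; apply/sat_Q.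
  have [i' [hi' /(proj1 (sR _)) e]] := D_sorted hR; subst i'.
  by have := hi' k; rewrite !ffunE /=.
- have [i hi] := dom_sorted (r x).
  apply: (@sat_bigOr _ _ _ _ _ _ _ _ _ (Q i (Var x))); last exact/sat_Q.
  by apply/In_map; exists i => //; apply/In_mem.
Qed.

(** Under an assignment respecting sorts, a well-sorted term never meets the junk value, so
    evaluating is substituting. *)
Lemma eval_tssubst r t i :
  {in tfv t, forall x, has_sort (sval (r x)) (vsort x)} -> has_sort t i ->
  sval (meval r t) = tssubst (fun x => sval (r x)) t.
Proof.
elim/term_ffun_ind: t i => [x|f ts IH] i hr // ht.
have [a ha fa] := has_sort_app_inv ht.
have e : vals [ffun k => meval r (ts k)] =
    [ffun k => tssubst (fun x => sval (r x)) (ts k)].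
  apply/ffunP => k; rewrite !ffunE; apply: IH (ha k) => x hx.
  by apply: hr; apply/mem_tfvs; exists k.
rewrite /= (@fun_int_sorted _ _ i) e //.
exact: (has_sort_tssubst hr ht).
Qed.

(** Truth in the model is tied to [D] only for assignments that respect the sorts of the free
    variables. The guard Q_i of a translated quantifier restricts the new value to the right sort
    and so preserves this condition. *)
Lemma truth_lemma r A :
  {subset bv A <= S} -> well_sorted A ->
  {in fv A, forall x, has_sort (sval (r x)) (vsort x)} ->
  msat r (tr A) <-> D (ssubst (fun x => sval (r x)) A).
Proof.
have upd_sorted r' x B (d : dom) :
    {in [seq y <- fv B | y != x], forall y, has_sort (sval (r' y)) (vsort y)} ->
    has_sort (sval d) (vsort x) ->
    {in fv B, forall y, has_sort (sval (upd r' x d y)) (vsort y)}.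
  move=> hr hd y hy; rewrite /upd; case: eqP => [-> //|/eqP ne].
  by apply: hr; rewrite mem_filter ne.
(* Elements of the model avoid [S], hence [x], so the quantified variable can be instantiated after
   all the others. *)
have upd_subst r' x B (d : dom) : x \in S ->
    ssubst (fun y => sval (upd r' x d y)) B =
    subst x (sval d) (ssubst (upd (fun y => sval (r' y)) x (Var x)) B).
  move=> xS; rewrite subst_ssubst.
  - by apply: ssubst_ext => z _; rewrite /upd; case: eqP.
  - by rewrite /upd eqxx.
  - move=> z /negbTE ne; rewrite /upd ne.
    by case: (r' z) => t [_ ht] /=; apply: contraL xS => /ht.
have upd_wf r' x B :
    {in [seq y <- fv B | y != x], forall y, has_sort (sval (r' y)) (vsort y)} ->
    well_sorted B ->
    well_sorted (ssubst (upd (fun y => sval (r' y)) x (Var x)) B).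
  move=> hr wB; apply: well_sorted_ssubst => // y hy; rewrite /upd.
  case: eqP => [->|/eqP ne]; first exact: has_sort_var.
  by apply: hr; rewrite mem_filter ne.
elim: A r => [|t u|R ts|B IHB C IHC|B IHB C IHC|B IHB C IHC|x B IHB|x B IHB] r hS wA hr.
- by split=> // h; apply: D_consistent; apply: D_ass.
- case: wA => i [ht hu].
  by rewrite /= /eq_int (@eval_tssubst r t i) ?(@eval_tssubst r u i) //
    => x hx; apply: hr; rewrite mem_cat hx ?orbT.
- case: wA => i [hts _] /=.
  suff -> : vals [ffun k => meval r (ts k)] =
    [ffun k => tssubst (fun x => sval (r x)) (ts k)] by [].
  apply/ffunP => k; rewrite !ffunE; apply: eval_tssubst (hts k) => x hx.
  by apply: hr; apply/mem_tfvs; exists k.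
- case: wA => wB wC /=.
  rewrite IHB ?IHC //; first (by split=> /D_And);
    by move=> z hz; (apply: hS || apply: hr); rewrite mem_cat hz ?orbT.
- case: wA => wB wC /=; rewrite D_Or; first last.
  + by apply: well_sorted_ssubst => // z hz; apply: hr; rewrite mem_cat hz orbT.
  + by apply: well_sorted_ssubst => // z hz; apply: hr; rewrite mem_cat hz.
  rewrite IHB ?IHC //;
    by move=> z hz; (apply: hS || apply: hr); rewrite mem_cat hz ?orbT.
- case: wA => wB wC /=; rewrite D_Imp; first last.
  + by apply: well_sorted_ssubst => // z hz; apply: hr; rewrite mem_cat hz orbT.
  + by apply: well_sorted_ssubst => // z hz; apply: hr; rewrite mem_cat hz.
  rewrite IHB ?IHC //;
    by move=> z hz; (apply: hS || apply: hr); rewrite mem_cat hz ?orbT.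
- have xS : x \in S by apply: hS; rewrite inE eqxx.
  have hB : {subset bv B <= S} by move=> z hz; apply: hS; rewrite inE hz orbT.
  rewrite [ssubst _ _]/= D_All ?bv_ssubst //; last exact: upd_wf.
  split=> [h t ht tS|h d].
    pose d := in_dom ht tS.
    have := h d; rewrite -/(tr B) -[t]/(sval d) -upd_subst // => hd.
    apply/IHB => //; first exact: upd_sorted.
    by apply: hd; apply/sat_Q; rewrite /= /upd eqxx.
  move=> /sat_Q; rewrite /= {1}/upd eqxx => hd.
  apply/IHB => //; first exact: upd_sorted.
  by rewrite upd_subst //; apply: h => //; case: (d) => t [].
- have xS : x \in S by apply: hS; rewrite inE eqxx.
  have hB : {subset bv B <= S} by move=> z hz; apply: hS; rewrite inE hz orbT.
  rewrite [ssubst _ _]/= D_Ex ?bv_ssubst //; last exact: upd_wf.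
  split=> [[d [/sat_Q]]|[t [ht tS h]]].
    rewrite /= {1}/upd eqxx => hd /IHB hB'; exists (sval d); split=> //.
      by case: (d) => t [].
    by rewrite -upd_subst //; apply: hB' => //; apply: upd_sorted.
  pose d := in_dom ht tS.
  exists d; split; first by apply/sat_Q; rewrite /= /upd eqxx.
  apply/IHB => //; first exact: upd_sorted.
  by rewrite upd_subst.
Qed.

End TermModel.

(** * From unsorted to many-sorted derivations *)

Lemma fol_to_msl (L : msl_sig) (T : sform L -> Prop) (A : sform L) :
  (forall B, T B -> well_sorted B /\ sentence B) ->
  well_sorted A -> sentence A ->
  fol_derives (fun B : uform L => (exists2 C, T C & B = tr C) \/ Jplus B) (tr A) ->
  msl_derives T A.
Proof.
move=> hT wA sA [G hG d]; apply: NNPP => underivable.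
(* The sorted originals of the finitely many translated premises are collected, since the truth
   lemma is applied to these and to [A] only. *)
have [G1 hG1 GG1] : exists2 G1 : seq (sform L), forall C, List.In C G1 -> T C &
    forall B, List.In B G ->
      (exists2 C, List.In C G1 & B = tr C) \/ Jplus B \/ fol_eq B.
  elim: {d} G hG => [|B G IH] hG; first by exists [::].
  have [|G1 hG1 GG1] := IH; first by move=> C hC; apply: hG; right.
  case: (hG B (or_introl erefl)) => [[[C hC eB]|hB]|hB]; first last.
  - by exists G1 => // E [<-|/GG1 //]; right; right.
  - by exists G1 => // E [<-|/GG1 //]; right; left.
  exists (C :: G1) => [E [<- //|/hG1 //]|E [<-|/GG1 [[E' hE eE]|hE]]].
  - by left; exists C => //; left.
  - by left; exists E' => //; right.
  - by right.
(* Only finitely many bound variables occur, so the witnesses and the terms of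
   the model can avoid them and substitution never captures a variable. *)
pose S := flatten [seq bv C | C <- A :: G1].
pose U (B : sform L) := T B \/ msl_eq B.
have sU B : U B -> sentence B by case=> [/hT []|/msl_eq_sentence].
have wU B : U B -> well_sorted B by case=> [/hT []|/msl_eq_sorted].
have st : state U [:: Neg A].
  split=> [B [<-|[]] //|[G' hG' d']]; apply: underivable.
  suff [G2 hG2 d2] : der (@well_sorted L) (fun x t => has_sort t (vsort x)) U A.
    by exists G2.
  by apply: der_raa => //; exists G' => // B /hG' [|[->|[]]]; [right|left].
have [D [UD AD wD cD [mD hD]]] := @henkin_completion L U S sU wU _ st.
have [i0] := sort_inh L; have [d0 _] := dom_inh S i0.
have eD B : msl_eq B -> D B by move=> hB; apply: UD; right.
have inS C : List.In C (A :: G1) -> {subset bv C <= S}.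
  rewrite /S; elim: (A :: G1) => //= C' l IH [->|/IH h] z hz;
    by rewrite mem_cat ?hz // h ?orbT.
(* Sentences have no free variables, so the constant assignment respects sorts vacuously and the
   substitution does nothing. *)
have tr_sat C : List.In C (A :: G1) -> well_sorted C -> sentence C ->
    sat (@fun_int L S d0) (@eq_int L D S) (@rel_int L D S) (fun _ => d0) (tr C)
    <-> D C.
  move=> hC wC sC.
  rewrite (truth_lemma wD cD mD hD) ?ssubst_sentence ?sC //.
  exact: inS.
have /(tr_sat A (or_introl erefl) wA sA) hA : sat (@fun_int L S d0) (@eq_int L D S)
    (@rel_int L D S) (fun _ => d0) (tr A).
  apply: (nd_sound d) => B /GG1 [[C hC ->]|[hB|hB]].
  - have [wC sC] := hT C (hG1 C hC).
    by apply/tr_sat => //; [right|apply: UD; left; apply: hG1].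
  - exact: sat_Jplus.
  - exact: sat_fol_eq.
apply: cD; apply: (@der_impE _ _ _ _ _ _ A).
  by apply: der_ass => //; apply: AD; left.
exact: der_ass.
Qed.

Theorem theorem5p2 (L : msl_sig) (Gamma : sform L -> Prop) (phi : sform L)
  (hGamma : forall A, Gamma A -> well_sorted A /\ sentence A)
  (hphi : well_sorted phi /\ sentence phi) :
  msl_derives Gamma phi <->
  fol_derives (fun B : uform L => (exists2 A, Gamma A & B = tr A) \/ Jplus B)
    (tr phi).
Proof.
case: hphi => wphi sphi; split.
  by apply: msl_to_fol => // B /hGamma [].
exact: fol_to_msl.
Qed.
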